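(* For every integer $n\ge 1$, the number of (isomorphism classes of) rooted bridgeless combinatorial maps of size $n$ is equal to the number of (isomorphism classes of) rooted connected chord diagrams of size $n$.
   Context: A rooted chord diagram of size $n$ is (up to isomorphism) a perfect matching of the linearly ordered set $\{0<1<\dots<2n-1\}$ into $n$ pairs $(a,b)$ with $a<b$, called chords; the root chord is the chord containing $0$. Two chords $(a,b)$ and $(c,d)$ cross if $a<c<b<d$ or $c<a<d<b$. A diagram is connected if the graph whose vertices are the chords and whose edges join crossing chords is connected. A rooted combinatorial map is a quadruple $(H,\sigma,\alpha,r)$ where $H$ is a finite set of half-edges, $\sigma$ is a permutation of $H$, $\alpha$ is an involution of $H$, $r\in H$ satisfies $\alpha(r)=r$, and the group generated by $\sigma,\alpha$ acts transitively on $H$; isomorphisms are bijections commuting with $\sigma,\alpha$ and preserving $r$. Here maps are closed: $r$ is the only fixed point of $\alpha$. The underlying graph has the $\sigma$-orbits as vertices and the $\alpha$-orbits as edges (the orbit $\{r\}$ is a dangling edge, the root), an edge being incident to the vertices it meets. The size of a map is the number of $\alpha$-orbits (the root counts as an edge), so the map with a single half-edge has size $1$. A map is bridgeless if its underlying graph has no edge whose deletion disconnects it. *)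

(* Defs.v *)
From mathcomp Require Import all_boot all_fingroup.
Set Implicit Arguments. Unset Strict Implicit. Unset Printing Implicit Defensive.

Section Chords.
Variable m : nat.
Local Notation T := 'I_m.

Definition perfect_matching (P : {set {set T}}) : bool :=
  partition P [set: T] && [forall C in P, #|C| == 2].

Definition chords_cross (C D : {set T}) : bool :=
  [exists a : T, exists b : T, exists c : T, exists d : T,
     [&& C == [set a; b], D == [set c; d] &
        ((a < c < b) && (b < d)) || ((c < a < d) && (d < b))]].

Definition cross_rel (P : {set {set T}}) : rel {set T} :=
  fun C D => [&& C \in P, D \in P & chords_cross C D].

Definition diagram_connected (P : {set {set T}}) : bool :=
  [forall C in P, forall D in P, connect (cross_rel P) C D].
End Chords.

(* Connected chord diagrams of size n: perfect matchings of 'I_(2n).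
   (Isomorphisms of chord diagrams are order-preserving bijections of the
   linearly ordered ground set, hence identities, so isomorphism classes
   are exactly the matchings themselves.) *)
Definition connected_diagrams (n : nat) : {set {set {set 'I_(n.*2)}}} :=
  [set P | perfect_matching P && diagram_connected P].

Section Maps.
Variable k : nat.
Local Notation T := 'I_k.

(* a map on half-edge set T: (sigma, alpha, root) *)
Definition rmap := ({perm T} * {perm T} * T)%type.

Definition msigma (M : rmap) : {perm T} := M.1.1.
Definition malpha (M : rmap) : {perm T} := M.1.2.
Definition mroot (M : rmap) : T := M.2.

Definition is_closed_rmap (M : rmap) : bool :=
  [forall h : T, malpha M (malpha M h) == h] &&
  [forall h : T, (malpha M h == h) == (h == mroot M)] &&
  [forall h : T, orbit 'P%act <<[set msigma M; malpha M]>>%g h == [set: T]].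

Definition rmap_iso (M M' : rmap) : bool :=
  [exists f : {perm T},
     [forall h : T, f (msigma M h) == msigma M' (f h)] &&
     [forall h : T, f (malpha M h) == malpha M' (f h)] &&
     (f (mroot M) == mroot M')].

Definition mvertex (M : rmap) (h : T) : {set T} := porbit (msigma M) h.
Definition medge (M : rmap) (h : T) : {set T} := porbit (malpha M) h.
Definition medges (M : rmap) : {set {set T}} := [set medge M h | h : T].
Definition mvertices (M : rmap) : {set {set T}} := [set mvertex M h | h : T].

Definition adj_minus (M : rmap) (e : {set T}) : rel {set T} :=
  fun u v => [exists h : T,
     [&& u == mvertex M h, v == mvertex M (malpha M h) & medge M h != e]].

Definition is_bridge (M : rmap) (e : {set T}) : bool :=
  (e \in medges M) &&
  ~~ [forall u in mvertices M, forall v in mvertices M,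
        connect (adj_minus M e) u v].

Definition bridgeless (M : rmap) : bool :=
  [forall e in medges M, ~~ is_bridge M e].

Definition bridgeless_maps : {set rmap} :=
  [set M | is_closed_rmap M && bridgeless M].

Definition num_bridgeless_classes : nat :=
  #|equivalence_partition rmap_iso bridgeless_maps|.
End Maps.

(* Main.v *)
Require Import Defs.
From mathcomp Require Import all_boot order all_fingroup zify.
Set Implicit Arguments. Unset Strict Implicit. Unset Printing Implicit Defensive.

(* Write c_n for the number of connected diagrams and b_n for the number of bridgeless
   maps of size n.  Both satisfy x_1 = 1 and
   x_n = \sum_(1 <= k < n) (2k - 1) x_k x_(n-k).
   - Diagrams: delete the root chord and take the component of the next endpoint.  It
     has some size k, and everything else sits in one of its 2k - 1 inner gaps and
     forms, with the root chord, a connected diagram of size n - k.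
   - Maps: let h follow the root r in its vertex.  Detaching h from that vertex leaves
     a chain of bridgeless maps joined by bridges, starting at r and ending at h.  The
     first one has size k, its bridge leaves from one of 2k - 1 corners, and the rest
     of the chain is closed up into a bridgeless map by reattaching h next to the other
     end of that bridge.
   Maps are counted with labelled half-edges; as rooted maps are rigid, there are
   (2n - 1)! labellings of each.  Connectivity means that no set closed under the
   allowed moves splits the ground set. *)

(** * Counting and orbits *)

Lemma card_dep_pairs (I J : finType) (P : pred I) (D : I -> {set J}) :
  #|[set q : I * J | P q.1 && (q.2 \in D q.1)]| = \sum_(i | P i) #|D i|.
Proof.
rewrite -sum1_card.
transitivity (\sum_(i | P i) \sum_(j in D i) 1).
  by rewrite pair_big_dep; apply: eq_bigl => q; rewrite inE.
by apply: eq_bigr => i _; rewrite sum1_card.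
Qed.

Lemma sum_card_sets (T : finType) (F : nat -> nat) :
  \sum_(H : {set T}) F #|H| = \sum_(j < #|T|.+1) 'C(#|T|, j) * F j.
Proof.
have inordH (H : {set T}) : (inord #|H| : 'I_#|T|.+1) = #|H| :> nat.
  by rewrite inordK // ltnS max_card.
rewrite (partition_big (fun H : {set T} => inord #|H| : 'I_#|T|.+1) xpredT) //=.
apply: eq_bigr => j _; rewrite -card_draws -sum_nat_const.
apply: congr_big => //= [H|H /eqP <-]; last by rewrite inordH.
by rewrite inE -val_eqE /= inordH.
Qed.

Lemma imset_enum_val (T : finType) (H : {set T}) :
  [set @enum_val T (mem H) i | i in setT] = H.
Proof.
apply/setP => x; apply/imsetP/idP => [[i _ ->]|xH]; first exact: enum_valP.
by exists (enum_rank_in xH x); rewrite ?enum_rankK_in.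
Qed.

Lemma ord_neq_ltn m (u v : 'I_m) : (u != v) = (u < v) || (v < u).
Proof. by rewrite -val_eqE neq_ltn. Qed.

Lemma card_ord_itv n a b : b <= n -> #|[set p : 'I_n | a <= p < b]| = b - a.
Proof.
move=> bn; rewrite -[RHS]muln1 -sum_nat_const_nat (big_nat_widen _ _ n) //.
rewrite (big_nat_widenl _ 0) // big_mkord -sum1_card; apply: eq_bigl => p.
by rewrite inE andbC.
Qed.

Lemma porbit_involutive (T : finType) (a : {perm T}) x :
  involutive a -> porbit a x = [set x; a x].
Proof.
move=> aK; apply/setP => y; apply/porbitP/set2P => [[i ->]|[->|->]].
- elim: i => [|i]; first by rewrite expg0 perm1; left.
  by rewrite expgSr permM => -[->|->]; rewrite ?aK; auto.
- by exists 0; rewrite expg0 perm1.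
by exists 1; rewrite expg1.
Qed.

Lemma mem_porbits (T : finType) (a : {perm T}) y : porbit a y \in porbits a.
Proof. by apply: imset_f; rewrite inE. Qed.

Lemma porbits_partition (T : finType) (a : {perm T}) : partition (porbits a) [set: T].
Proof.
apply/and3P; split.
- rewrite eqEsubset subsetT; apply/subsetP => y _; apply/bigcupP.
  by exists (porbit a y); rewrite ?mem_porbits ?porbit_id.
- apply/trivIsetP => _ _ /imsetP[x _ ->] /imsetP[y _ ->] xy.
  apply/pred0P => z; apply: contraNF xy => /andP[] /=.
  by rewrite -!eq_porbit_mem => /eqP<-.
by apply/negP => /imsetP[x _ /setP/(_ x)]; rewrite porbit_id inE.
Qed.

(** * Stable sets and inseparable sets *)

Local Notation stable s A := (s \in 'N(A | 'P)%g).

Section Stable.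
Variable T : finType.
Implicit Types (s t u v : {perm T}) (A B H K : {set T}) (x y : T).

Lemma stableP s A : reflect (forall y, (s y \in A) = (y \in A)) (stable s A).
Proof. by apply: (iffP astabsP) => sA y; apply: sA. Qed.

Lemma stableC s A : stable s (~: A) = stable s A.
Proof. by rewrite astabsC. Qed.

Lemma stableI s A B : stable s A -> stable s B -> stable s (A :&: B).
Proof. by move=> sA sB; rewrite (subsetP (astabsI _ _ _)) // inE sA. Qed.

Lemma stableU s A B : stable s A -> stable s B -> stable s (A :|: B).
Proof. by move=> sA sB; rewrite (subsetP (astabsU _ _ _)) // inE sA. Qed.

Lemma stable_set1 s x : s x = x -> stable s [set x].
Proof. by move=> sx; rewrite astabs_set1; apply/astab1P. Qed.

Lemma stableD1 s A x : s x = x -> stable s A -> stable s (A :\ x).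
Proof.
by move=> sx sA; rewrite setDE; apply: stableI => //; rewrite stableC stable_set1.
Qed.

Lemma perm_on_stable s H : perm_on H s -> stable s H.
Proof. by move=> sH; apply/stableP => y; rewrite perm_closed. Qed.

Lemma stable_involutive s A :
  involutive s -> (forall y, y \in A -> s y \in A) -> stable s A.
Proof. by move=> sK sA; apply/stableP => y; apply/idP/idP => /sA //; rewrite sK. Qed.

Lemma eq_in_stable s H A B :
  perm_on H s -> {in H, A =i B} -> stable s A -> stable s B.
Proof.
move=> sH AB /stableP sA; apply/stableP => y.
have [yH|yH] := boolP (y \in H); last by rewrite (out_perm sH).
by rewrite -!AB ?sA ?(perm_closed _ sH).
Qed.

Lemma stable_const s H A :
  perm_on H s -> {in H &, forall x y, (x \in A) = (y \in A)} -> stable s A.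
Proof.
move=> sH constA; apply/stableP => y.
have [yH|yH] := boolP (y \in H); last by rewrite (out_perm sH).
by apply: constA; rewrite ?(perm_closed _ sH).
Qed.

Lemma stableM_disjoint H K s t A :
  [disjoint H & K] -> perm_on H s -> perm_on K t ->
  stable (s * t)%g A = stable s A && stable t A.
Proof.
move=> HK sH tK; apply/idP/andP => [stA|[sA tA]]; last exact: groupM.
suff sA : stable s A by split=> //; rewrite -(groupMl t sA).
apply/stableP => y; have [yH|yH] := boolP (y \in H); last by rewrite (out_perm sH).
by rewrite -(stableP _ _ stA y) permM (out_perm tK) ?(disjointFr HK) ?(perm_closed _ sH).
Qed.

Lemma porbit_sub_stable s A y : stable s A -> (porbit s y \subset A) = (y \in A).
Proof. by move=> sA; rewrite porbitE acts_sub_orbit ?cycle_subG. Qed.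

Lemma perm_onS H K s : H \subset K -> perm_on H s -> perm_on K s.
Proof. by move=> HK sH; apply: subset_trans HK. Qed.

Lemma perm_on_mul_inj H K s t u v :
  [disjoint H & K] -> perm_on H s -> perm_on K t -> perm_on H u -> perm_on K v ->
  (s * t = u * v)%g -> s = u /\ t = v.
Proof.
move=> HK sH tK uH vK E; suff su : s = u by split=> //; apply: (mulgI u); rewrite -E su.
apply/permP => y; have [yH|yH] := boolP (y \in H); last first.
  by rewrite (out_perm sH) ?(out_perm uH).
have /permP/(_ y) := E; rewrite !permM.
by rewrite (out_perm tK) ?(out_perm vK) // (disjointFr HK) ?perm_closed.
Qed.

Lemma restr_permE_if s H y :
  stable s H -> restr_perm H s y = if y \in H then s y else y.
Proof.
move=> sH; case: ifPn => yH; first exact: restr_permE.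
exact: out_perm (restr_perm_on H s) yH.
Qed.

Lemma restr_permM_setC s H :
  stable s H -> (restr_perm H s * restr_perm (~: H) s)%g = s.
Proof.
move=> sH; apply/permP => y; rewrite permM !restr_permE_if ?stableC // inE.
by have [yH|yH] := boolP (y \in H); rewrite ?(stableP _ _ sH) ?yH // (negPf yH).
Qed.

Lemma perm_on_restr_permD1 s H x :
  s x = x -> stable s H -> perm_on (H :\ x) (restr_perm H s).
Proof.
move=> sx sH; apply/subsetP => y; rewrite inE restr_permE_if // in_setD1.
by case: ifPn => [yH|]; rewrite ?eqxx // andbT; apply: contraNneq => ->; rewrite sx.
Qed.

End Stable.

Section Inseparable.
Variable T : finType.
Implicit Types (P Q : pred {set T}) (A H : {set T}) (x : T).

Definition inseparable P H :=
  [forall A : {set T}, P A ==> (H \subset A) || [disjoint H & A]].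

Lemma inseparableP P H :
  reflect (forall A, P A -> {in H &, forall x y, (x \in A) = (y \in A)})
    (inseparable P H).
Proof.
apply: (iffP forall_inP) => insep A PA.
  case/orP: (insep A PA) => [/subsetP HA|HA] x y xH yH; first by rewrite !HA.
  by rewrite !(disjointFr HA).
have [HA|] := boolP [disjoint H & A]; first by rewrite orbT.
case/pred0Pn=> x /andP[/= xH xA]; rewrite orbF; apply/subsetP => y yH.
by rewrite (insep A PA y x).
Qed.

Lemma inseparable_sub P H A x :
  inseparable P H -> P A -> x \in H -> x \in A -> H \subset A.
Proof.
move=> /inseparableP insep PA xH xA; apply/subsetP => y yH.
by rewrite (insep A PA y x).
Qed.

Lemma inseparable_from P H x : (forall A, P A -> P (~: A)) -> x \in H ->
  (forall A, P A -> x \in A -> H \subset A) -> inseparable P H.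
Proof.
move=> PC xH from_x; apply/forall_inP => A PA.
have [xA|xA] := boolP (x \in A); first by rewrite from_x.
by rewrite disjoints_subset (from_x (~: A)) ?PC ?orbT ?inE.
Qed.

Definition component P x := \bigcap_(A : {set T} | P A && (x \in A)) A.

Lemma mem_component P x : x \in component P x.
Proof. by apply/bigcapP => A /andP[]. Qed.

Lemma component_closed P x : P setT -> (forall A B, P A -> P B -> P (A :&: B)) ->
  P (component P x).
Proof. by move=> PT PI; apply: (big_ind P) => // A /andP[]. Qed.

Lemma component_inseparable P x :
  (forall A, P A -> P (~: A)) -> inseparable P (component P x).
Proof.
move=> PC; apply: (inseparable_from PC (mem_component P x)) => A PA xA.
by apply: bigcap_inf; rewrite PA.
Qed.

End Inseparable.

Lemma inseparable_imset (S T : finType) (f : S -> T) (P : pred {set S})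
    (Q : pred {set T}) (H : {set S}) :
  injective f -> (forall A, Q A = P (f @^-1: A)) ->
  inseparable Q (f @: H) = inseparable P H.
Proof.
move=> fI QP; apply/inseparableP/inseparableP => insep A.
  move=> PA x y xH yH; rewrite -!(mem_imset _ _ fI); apply: insep; rewrite ?imset_f //.
  by rewrite QP (_ : f @^-1: _ = A) //; apply/setP => z; rewrite inE mem_imset.
rewrite QP => /insep PA _ _ /imsetP[x xH ->] /imsetP[y yH ->].
by have := PA x y xH yH; rewrite !inE.
Qed.

(** * Cutting and inserting an element of a cycle *)

Section CutInsert.
Variable T : finType.
Implicit Types (s a : {perm T}) (A H : {set T}) (x y z : T).

(* [cut s x] removes [s x] from its cycle; for an involution [a] this deletes the
   pair [{x, a x}]. *)
Definition cut s x := (tperm x (s x) * s)%g.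

(* For a fixed point [x] of [s], [insert x y s] makes [x] the successor of [y]. *)
Definition insert x y s := (tperm y x * s)%g.

Lemma insert_cut s x : insert (s x) x (cut s x) = s.
Proof. by rewrite /insert /cut tpermKg. Qed.

Lemma insertE x y s : s x = x -> insert x y s y = x.
Proof. by move=> sx; rewrite permM tpermL. Qed.

Lemma cut_insert x y s : s x = x -> cut (insert x y s) y = s.
Proof. by move=> sx; rewrite /cut insertE // /insert tpermKg. Qed.

Lemma cut_fix s x : cut s x (s x) = s x.
Proof. by rewrite permM tpermR. Qed.

Lemma cut_neq s x y : y != x -> y != s x -> cut s x y = s y.
Proof. by move=> yx ysx; rewrite permM tpermD // eq_sym. Qed.

Lemma stable_insert x y s A : s x = x ->
  stable (insert x y s) A = ((x \in A) == (y \in A)) && stable s A.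
Proof.
move=> sx; apply/idP/andP => [iA|[/eqP xy sA]].
  have xy : (x \in A) = (y \in A) by rewrite -[RHS](stableP _ _ iA) insertE.
  split; first by rewrite xy.
  rewrite -(groupMl _ (_ : stable (tperm y x) A)) //.
  by apply/stableP => z; case: tpermP => // ->.
by apply: groupM => //; apply/stableP => z; case: tpermP => // ->.
Qed.

Lemma stable_cut s x A :
  stable s A = ((s x \in A) == (x \in A)) && stable (cut s x) A.
Proof. by rewrite -{1}(insert_cut s x) stable_insert // cut_fix. Qed.

Lemma cut_stable s x A : stable s A -> stable (cut s x) A.
Proof. by rewrite (stable_cut s x) => /andP[]. Qed.

Lemma perm_on_insert x y s H :
  x \in H -> y \in H -> perm_on H s -> perm_on H (insert x y s).
Proof.
move=> xH yH; apply: perm_onM; apply: perm_onS (tperm_on y x).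
by rewrite subUset !sub1set yH.
Qed.

Lemma perm_on_cut s x H : x \in H -> perm_on H s -> perm_on H (cut s x).
Proof. by move=> xH sH; apply: perm_on_insert; rewrite ?perm_closed. Qed.

Lemma cut_id s x : s x = x -> cut s x = s.
Proof. by move=> sx; rewrite /cut sx tperm1 mul1g. Qed.

Lemma cut_insertC s x y z : z != x -> z != y -> s z != x -> s z != y ->
  cut (insert x y s) z = insert x y (cut s z).
Proof.
move=> zx zy szx szy; rewrite /cut permM tpermD 1?eq_sym // /insert !mulgA.
congr (_ * _)%g; apply: perm_onC (tperm_on _ _) (tperm_on _ _) _.
by rewrite disjoints_subset subUset !sub1set !inE !negb_or zx zy szx szy.
Qed.

Section DisjointProduct.
Variables (H K : {set T}) (s t : {perm T}).
Hypotheses (HK : [disjoint H & K]) (sH : perm_on H s) (tK : perm_on K t).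

Lemma cutMl x : x \notin K -> cut (s * t) x = (cut s x * t)%g.
Proof.
move=> xK; rewrite /cut permM (out_perm tK) ?mulgA //.
have [xH|xH] := boolP (x \in H); last by rewrite (out_perm sH).
by rewrite (disjointFr HK) ?perm_closed.
Qed.

Lemma cutMr x : x \notin H -> cut (s * t) x = (s * cut t x)%g.
Proof.
move=> xH; have stC : commute s (cut t x).
  have [xK|xK] := boolP (x \in K); first exact: perm_onC (perm_on_cut xK tK) HK.
  by rewrite cut_id ?(out_perm tK) //; apply: perm_onC HK.
by rewrite stC /cut permM (out_perm sH) // -mulgA (perm_onC sH tK).
Qed.

End DisjointProduct.

End CutInsert.

(** * Involutions with prescribed fixed points *)

Section FixingInvolution.
Variable T : finType.
Implicit Types (a b : {perm T}) (Z H : {set T}) (x y : T).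

Definition fixing_involution Z a :=
  [forall y, a (a y) == y] && [forall y, (a y == y) == (y \in Z)].

Lemma fixing_involutionP Z a :
  reflect (involutive a /\ forall y, (a y == y) = (y \in Z)) (fixing_involution Z a).
Proof.
apply: (iffP andP) => -[aK aZ].
  by split=> y; [exact: (eqP (forallP aK y)) | exact: (eqP (forallP aZ y))].
by split; apply/forallP => y; rewrite ?aK ?aZ.
Qed.

Lemma fixing_involution_on Z a H :
  fixing_involution Z a -> ~: H \subset Z -> perm_on H a.
Proof.
move=> /fixing_involutionP[_ aZ] HZ; apply/subsetP => y; rewrite inE aZ.
by apply: contraNT => yH; rewrite (subsetP HZ) ?inE.
Qed.

Lemma cut_involE a x y : involutive a ->
  cut a x y = if y \in [set x; a x] then y else a y.
Proof.
move=> aK; case: ifPn => [/set2P[]->|]; rewrite ?cut_fix ?permM ?tpermL ?aK //.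
by rewrite !inE negb_or => /andP[yx yax]; rewrite tpermD // eq_sym.
Qed.

Lemma cut_involutive a x : involutive a -> involutive (cut a x).
Proof.
move=> aK y; rewrite (cut_involE x y aK).
case: ifPn => yx; rewrite (cut_involE _ _ aK) ?yx // ifN ?aK //.
apply: contra yx; rewrite !inE (inj_eq perm_inj) -[a y == x](inj_eq (@perm_inj _ a)).
by rewrite aK orbC.
Qed.

Lemma fixing_involution_cut Z a x :
  fixing_involution Z a -> fixing_involution (x |: (a x |: Z)) (cut a x).
Proof.
case/fixing_involutionP=> aK aZ; apply/fixing_involutionP.
split=> [|y]; first exact: cut_involutive.
by rewrite (cut_involE _ _ aK) !inE orbA; case: ifP => _; rewrite ?eqxx ?aZ.
Qed.

Lemma fixing_involution_insert Z a x x' : x != x' -> x \in Z -> x' \in Z ->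
  fixing_involution Z a -> fixing_involution (Z :\ x :\ x') (insert x x' a).
Proof.
move=> xx' xZ x'Z /fixing_involutionP[aK aZ].
have ax : a x = x by apply/eqP; rewrite aZ.
have ax' : a x' = x' by apply/eqP; rewrite aZ.
have ix' : insert x x' a x' = x by apply: insertE.
have ix : insert x x' a x = x' by rewrite permM tpermR.
have iE y : y != x -> y != x' -> insert x x' a y = a y.
  by move=> yx yx'; rewrite permM tpermD // eq_sym.
apply/fixing_involutionP; split=> y.
  have [->|yx] := eqVneq y x; first by rewrite ix ix'.
  have [->|yx'] := eqVneq y x'; first by rewrite ix' ix.
  rewrite (iE y) // iE ?aK //; first by rewrite -ax (inj_eq perm_inj).
  by rewrite -ax' (inj_eq perm_inj).
rewrite !inE; have [->|yx'] := eqVneq y x'; first by rewrite ix' (negPf xx').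
have [->|yx] := eqVneq y x; first by rewrite ix eq_sym (negPf xx').
by rewrite iE ?aZ.
Qed.

Lemma fixing_involutionM Z1 Z2 a b : ~: Z1 \subset Z2 ->
  fixing_involution Z1 a -> fixing_involution Z2 b ->
  fixing_involution (Z1 :&: Z2) (a * b)%g.
Proof.
move=> /subsetP Z12 /fixing_involutionP[aK aZ] /fixing_involutionP[bK bZ].
have abE y : (a * b)%g y = if y \in Z1 then b y else a y.
  rewrite permM; case: ifPn => yZ; first by congr (b _); apply/eqP; rewrite aZ.
  by apply/eqP; rewrite bZ Z12 // inE -aZ (inj_eq perm_inj) aZ.
have bZ1 y : y \in Z1 -> b y \in Z1.
  move=> yZ; apply: contraT => byZ; have /eqP : b (b y) == b y by rewrite bZ Z12 ?inE.
  by rewrite bK => yb; rewrite -yb yZ in byZ.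
have aZ1 y : (a y \in Z1) = (y \in Z1) by rewrite -!aZ (inj_eq perm_inj).
apply/fixing_involutionP; split=> y; rewrite (abE y).
  by case: ifPn => yZ; rewrite abE ?bZ1 ?bK // aZ1 (negPf yZ) aK.
by rewrite inE; case: ifPn => yZ; rewrite ?bZ // aZ (negPf yZ).
Qed.

Lemma fixing_involution_restr Z a H : stable a H -> fixing_involution Z a ->
  fixing_involution (Z :|: ~: H) (restr_perm H a).
Proof.
move=> aH /fixing_involutionP[aK aZ].
apply/fixing_involutionP; split=> y; rewrite (restr_permE_if y aH).
  by case: ifPn => yH; rewrite restr_permE_if ?(stableP _ _ aH) ?(negPf yH) ?yH ?aK.
by rewrite !inE; case: ifPn => yH; rewrite ?eqxx ?aZ ?orbF ?orbT.
Qed.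

End FixingInvolution.

(** * Labelled bridgeless maps *)

Section LabelledMaps.
Variable T : finType.
Implicit Types (s a : {perm T}) (A H K : {set T}) (r x y z : T).

Definition jointly_stable s a : pred {set T} := fun A => stable s A && stable a A.

Definition labelled_map H s a r :=
  [&& perm_on H s, r \in H & fixing_involution (r |: ~: H) a].

(* For [x = r] nothing is cut, so this includes connectedness. *)
Definition two_edge_connected H s a :=
  [forall x in H, inseparable (jointly_stable s (cut a x)) H].

Definition bridgeless_labelled_maps H : {set {perm T} * {perm T} * T} :=
  [set M | labelled_map H M.1.1 M.1.2 M.2 && two_edge_connected H M.1.1 M.1.2].

Lemma labelled_map_involutive H s a r : labelled_map H s a r -> involutive a.
Proof. by case/and3P=> _ _ /fixing_involutionP[]. Qed.

Lemma labelled_map_fix H s a r y :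
  labelled_map H s a r -> y \in H -> (a y == y) = (y == r).
Proof.
by case/and3P=> _ _ /fixing_involutionP[_ ->] yH; rewrite !inE yH orbF.
Qed.

Lemma labelled_map_root H s a r : labelled_map H s a r -> a r = r.
Proof.
by case/and3P=> _ _ /fixing_involutionP[_ aZ]; apply/eqP; rewrite aZ !inE eqxx.
Qed.

Lemma labelled_map_alpha_on H s a r : labelled_map H s a r -> perm_on H a.
Proof. by case/and3P=> _ _ /fixing_involution_on; apply; apply: subsetUr. Qed.

Lemma two_edge_connected_sub H s a x y A : two_edge_connected H s a ->
  x \in H -> stable s A -> stable (cut a x) A -> y \in H -> y \in A -> H \subset A.
Proof.
move=> /forall_inP conn /conn insep sA aA; apply: (inseparable_sub insep).
by apply/andP.
Qed.

Lemma two_edge_connected_from H s a y : y \in H ->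
  (forall x A, x \in H -> stable s A -> stable (cut a x) A -> y \in A -> H \subset A) ->
  two_edge_connected H s a.
Proof.
move=> yH from_y; apply/forall_inP => x xH; apply: inseparable_from yH _ => A.
  by rewrite /jointly_stable !stableC.
by case/andP; apply: from_y.
Qed.

(* Otherwise the edge of [s r] would be a bridge: its deletion would separate
   [s r |: A] from [a (s r)]. *)
Lemma two_edge_connected_detach H s a r A : labelled_map H s a r ->
  two_edge_connected H s a -> stable (cut s r) A -> stable a A ->
  (s r \in A) = (r \in A).
Proof.
move=> M conn; have /and3P[sH rH _] := M.
wlog rA : A / r \in A => [wlog_rA sA aA|sA aA].
  have [rA|rA] := boolP (r \in A); first by rewrite wlog_rA.
  by have := wlog_rA (~: A); rewrite !stableC !in_setC rA => /(_ isT sA aA)/negbTE.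
rewrite rA; apply: contraT => hA; have hH : s r \in H by rewrite perm_closed.
have ss : stable s (s r |: A).
  rewrite (stable_cut _ r) !in_setU1 eqxx rA orbT /=.
  by apply: stableU; rewrite ?stable_set1 ?cut_fix.
have sa : stable (cut a (s r)) (s r |: A).
  apply: stableU; last exact: cut_stable.
  by apply: stable_set1; rewrite permM tpermL (labelled_map_involutive M).
have ahH : a (s r) \in H by rewrite perm_closed // (labelled_map_alpha_on M).
have := subsetP (two_edge_connected_sub conn hH ss sa rH (setU1r _ rA)) _ ahH.
rewrite !inE (stableP _ _ aA) (negPf hA) orbF (labelled_map_fix M) // => /eqP hr.
by rewrite hr rA in hA.
Qed.

End LabelledMaps.

(** * Gluing two bridgeless maps *)

Section Glue.
Variable T : finType.
Implicit Types (s a : {perm T}) (A H : {set T}) (r x y z : T).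

(* A new bridge [{x, x'}] joins the first map, where [x] is inserted after [y],
   to the second one, of root [x']; the half-edge [s2 x'] is detached from [x'] in
   [glue_core], and reattached after the root [r] in [glue_sigma]. *)
Definition glue_core x y s1 s2 x' := (insert x y s1 * cut s2 x')%g.
Definition glue_sigma x y s1 r s2 x' := insert (s2 x') r (glue_core x y s1 s2 x').
Definition glue_alpha x a1 a2 x' := (a1 * insert x x' a2)%g.

Definition gluable H x y s1 a1 r s2 a2 x' :=
  [&& x \notin H, y \in H, labelled_map H s1 a1 r &
      labelled_map (~: (x |: H)) s2 a2 x'].

End Glue.

Section GlueTheory.
Variables (T : finType) (H : {set T}) (x y0 : T) (s1 a1 : {perm T}) (r : T).
Variables (s2 a2 : {perm T}) (x' : T).
Hypothesis G : gluable H x y0 s1 a1 r s2 a2 x'.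
Implicit Types (A : {set T}) (y z : T).

Local Notation V := (x |: H).
Local Notation core := (glue_core x y0 s1 s2 x').
Local Notation sigma := (glue_sigma x y0 s1 r s2 x').
Local Notation alpha := (glue_alpha x a1 a2 x').

Let xH : x \notin H. Proof. by case/and4P: G. Qed.
Let y0H : y0 \in H. Proof. by case/and4P: G. Qed.
Let M1 : labelled_map H s1 a1 r. Proof. by case/and4P: G. Qed.
Let M2 : labelled_map (~: V) s2 a2 x'. Proof. by case/and4P: G. Qed.
Let rH : r \in H. Proof. by case/and3P: M1. Qed.
Let s1H : perm_on H s1. Proof. by case/and3P: M1. Qed.
Let s2K : perm_on (~: V) s2. Proof. by case/and3P: M2. Qed.
Let a1H : perm_on H a1 := labelled_map_alpha_on M1.
Let a2K : perm_on (~: V) a2 := labelled_map_alpha_on M2.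
Let x'K : x' \in ~: V. Proof. by case/and3P: M2. Qed.
Let hK : s2 x' \in ~: V. Proof. by rewrite perm_closed. Qed.
Let x'x : x' != x. Proof. by apply: contraTneq x'K => ->; rewrite !inE eqxx. Qed.
Let x'H : x' \notin H.
Proof. by apply: contraTN x'K => x'H; rewrite !inE x'H orbT. Qed.
Let H_neq y : y \in H -> (y != x) && (y != x').
Proof.
by move=> yH; apply/andP; split; [apply: contraNneq xH|apply: contraNneq x'H] => <-.
Qed.
Let s1x : s1 x = x. Proof. exact: out_perm s1H xH. Qed.
Let a2x : a2 x = x. Proof. by rewrite (out_perm a2K) // !inE eqxx. Qed.
Let a2x' : a2 x' = x'. Proof. exact: labelled_map_root M2. Qed.
Let VK : [disjoint V & ~: V]. Proof. by rewrite disjoints_subset setCK. Qed.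
Let HCH : [disjoint H & ~: H]. Proof. by rewrite disjoints_subset setCK. Qed.
Let KCH : ~: V \subset ~: H. Proof. by rewrite setCS subsetUr. Qed.

Lemma perm_on_glue_core_first : perm_on V (insert x y0 s1).
Proof. by rewrite perm_on_insert ?(perm_onS _ s1H) ?subsetUr ?setU11 ?setU1r. Qed.

Lemma perm_on_glue_core_second : perm_on (~: V) (cut s2 x').
Proof. exact: perm_on_cut. Qed.

Lemma perm_on_glue_alpha_second : perm_on (~: H) (insert x x' a2).
Proof. by rewrite perm_on_insert ?(perm_onS _ a2K) // inE. Qed.

Lemma stable_glue_core A : stable core A =
  [&& (x \in A) == (y0 \in A), stable s1 A & stable (cut s2 x') A].
Proof.
rewrite (stableM_disjoint _ VK perm_on_glue_core_first perm_on_glue_core_second).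
by rewrite (stable_insert _ _ s1x) andbA.
Qed.

Lemma glue_core_pred : core y0 = x.
Proof. by rewrite permM insertE // (out_perm perm_on_glue_core_second) // !inE eqxx. Qed.

Let core_h : core (s2 x') = s2 x'.
Proof. by rewrite permM (out_perm perm_on_glue_core_first) ?cut_fix -1?in_setC. Qed.

Lemma glue_sigma_root : sigma r = s2 x'. Proof. exact: insertE. Qed.

Lemma cut_glue_sigma : cut sigma r = core. Proof. exact: cut_insert. Qed.

Lemma stable_glue_sigma A :
  stable sigma A = ((s2 x' \in A) == (r \in A)) && stable core A.
Proof. exact: stable_insert. Qed.

Lemma glue_alpha_first y : y \in H -> alpha y = a1 y.
Proof.
by move=> yH; rewrite permM (out_perm perm_on_glue_alpha_second) // inE negbK perm_closed.
Qed.

Lemma glue_alpha_bridge : alpha x = x'.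
Proof. by rewrite permM (out_perm a1H) // permM tpermR. Qed.

Lemma stable_cut_glue_alpha_first z A : z \in H ->
  stable (cut alpha z) A =
  [&& stable (cut a1 z) A, (x \in A) == (x' \in A) & stable a2 A].
Proof.
move=> zH; rewrite (cutMl HCH a1H perm_on_glue_alpha_second) ?in_setC ?negbK //.
rewrite (stableM_disjoint _ HCH (perm_on_cut zH a1H) perm_on_glue_alpha_second).
by rewrite (stable_insert _ _ a2x).
Qed.

Lemma stable_cut_glue_alpha_second z A : z \in ~: V -> z != x' ->
  stable (cut alpha z) A =
  [&& stable a1 A, (x \in A) == (x' \in A) & stable (cut a2 z) A].
Proof.
move=> zK zx'; have zx : z != x by apply: contraTneq zK => ->; rewrite !inE eqxx.
have zH : z \in ~: H := subsetP KCH z zK.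
have a2zx : a2 z != x by rewrite -a2x (inj_eq perm_inj).
have a2zx' : a2 z != x' by rewrite -a2x' (inj_eq perm_inj).
rewrite (cutMr HCH a1H perm_on_glue_alpha_second) -1?in_setC //.
rewrite (stableM_disjoint _ HCH a1H (perm_on_cut zH perm_on_glue_alpha_second)).
by rewrite (cut_insertC (s := a2)) // [in LHS]stable_insert // cut_neq // eq_sym.
Qed.

Lemma stable_cut_glue_alpha_bridge z A : z \in [set x; x'] ->
  stable (cut alpha z) A = stable a1 A && stable a2 A.
Proof.
move=> z_xx'; have zH : z \notin H by case/set2P: z_xx' => ->.
rewrite (cutMr HCH a1H perm_on_glue_alpha_second) //.
suff -> : cut (insert x x' a2) z = a2.
  by rewrite (stableM_disjoint _ HCH) // (perm_onS KCH).
case/set2P: z_xx' => ->; last exact: cut_insert.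
by rewrite /cut permM tpermR a2x' tpermC /insert tpermKg.
Qed.

Lemma stable_cut_glue_alpha_parts z A : stable (cut alpha z) A ->
  exists z1 z2, [/\ z1 \in H, z2 \in ~: V, stable (cut a1 z1) A,
    stable (cut a2 z2) A & (x \in A) = (x' \in A) \/ stable a2 A].
Proof.
have cut_a1r : cut a1 r = a1 := cut_id (labelled_map_root M1).
have cut_a2x' : cut a2 x' = a2 := cut_id a2x'.
have [zH|zH] := boolP (z \in H).
  rewrite stable_cut_glue_alpha_first // => /and3P[? /eqP ? ?].
  by exists z, x'; rewrite cut_a2x'; split; auto.
have [zb|zb] := boolP (z \in [set x; x']).
  rewrite stable_cut_glue_alpha_bridge // => /andP[? ?].
  by exists r, x'; rewrite cut_a1r cut_a2x'; split; auto.
have [zx zx'] : z != x /\ z != x' by move: zb; rewrite !inE => /norP.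
have zK : z \in ~: V by rewrite !inE negb_or zx.
rewrite stable_cut_glue_alpha_second // => /and3P[? /eqP ? ?].
by exists r, z; rewrite cut_a1r; split; auto.
Qed.

Lemma glue_labelled_map : labelled_map setT sigma alpha r.
Proof.
apply/and3P; split; rewrite ?inE //; first by apply/subsetP => y; rewrite inE.
have /and3P[_ _ Fa1] := M1; have /and3P[_ _ Fa2] := M2.
have xx' : x != x' by rewrite eq_sym.
have := fixing_involution_insert xx' _ _ Fa2; rewrite setCK setU11 setU1r ?setU11 //.
move=> /(_ isT isT) /(fixing_involutionM _ Fa1).
have -> : (r |: ~: H) :&: ((x' |: V) :\ x :\ x') = r |: ~: setT.
  apply/setP => y; rewrite !inE orbF.
  have [->|yr] /= := eqVneq y r; last first.
    have [yH|yH] := boolP (y \in H) => //=.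
    by have [|yx'] := eqVneq y x' => //=; have [|yx] := eqVneq y x.
  by rewrite rH !orbT !andbT andbC H_neq.
apply; rewrite setCU setCK; apply/subsetP => y; rewrite !inE => /andP[_ yH].
by rewrite yH !orbT andbT andbC H_neq.
Qed.

Lemma first_side_sub z A : two_edge_connected H s1 a1 ->
  stable core A -> stable (cut alpha z) A -> r \in A -> V \subset A.
Proof.
move=> conn1; rewrite stable_glue_core => /and3P[/eqP xy0 s1A _].
move=> /stable_cut_glue_alpha_parts[z1 [_ [z1H _ a1A _ _]]] rA.
have HA := two_edge_connected_sub conn1 z1H s1A a1A rH rA.
by rewrite subUset sub1set HA xy0 (subsetP HA).
Qed.

Lemma glue_two_edge_connected : two_edge_connected H s1 a1 ->
  two_edge_connected (~: V) s2 a2 -> two_edge_connected setT sigma alpha.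
Proof.
move=> conn1 conn2; apply: (two_edge_connected_from (in_setT r)) => z A _ sA aA rA.
have /andP[/eqP hr cA] : ((s2 x' \in A) == (r \in A)) && stable core A.
  by rewrite -stable_glue_sigma.
have VA := first_side_sub conn1 cA aA rA.
have [_ [z2 [_ z2K _ a2A xx'A]]] := stable_cut_glue_alpha_parts aA.
have /and3P[_ _ s2A] : [&& (x \in A) == (y0 \in A), stable s1 A & stable (cut s2 x') A].
  by rewrite -stable_glue_core.
have x'A : x' \in A.
  case: xx'A => [<-|a2A']; first by rewrite (subsetP VA) ?setU11.
  by rewrite -(two_edge_connected_detach M2 conn2 s2A a2A') hr.
have KA : ~: V \subset A.
  apply: (two_edge_connected_sub conn2 z2K _ a2A x'K x'A).
  by rewrite (stable_cut s2 x') hr rA x'A.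
by rewrite -(setUCr V) subUset VA.
Qed.

(* Outside [H], extend [A] by the side of [y0]: the resulting set is stable in the
   glued map. *)
Lemma two_edge_connected_glue_first : two_edge_connected setT sigma alpha ->
  (forall z A, stable core A -> stable (cut alpha z) A -> r \in A ->
    s2 x' \notin A -> ~~ (A \subset H)) ->
  two_edge_connected H s1 a1.
Proof.
move=> conn no_cut; apply: (two_edge_connected_from rH) => z A zH sA aA rA.
pose B := [set y | if y \in H then y \in A else y0 \in A].
have BH : {in H, A =i B} by move=> y yH; rewrite inE yH.
have BCH y : y \notin H -> (y \in B) = (y0 \in A) by move=> yH; rewrite inE (negPf yH).
have constK : {in ~: V &, forall u v, (u \in B) = (v \in B)}.
  by move=> u v /(subsetP KCH) uH /(subsetP KCH) vH; rewrite !BCH -1?in_setC.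
have cB : stable core B.
  rewrite stable_glue_core (eq_in_stable s1H BH sA).
  by rewrite (stable_const perm_on_glue_core_second) // -(BH y0) // BCH // eqxx.
have aB : stable (cut alpha z) B.
  rewrite stable_cut_glue_alpha_first // (stable_const a2K) // !BCH // eqxx !andbT.
  exact: eq_in_stable (perm_on_cut zH a1H) BH aA.
have rB : r \in B by rewrite -BH.
have hB : s2 x' \in B.
  apply: contraT => hB; have := no_cut z B cB aB rB hB.
  have /negPf y0A : y0 \notin A by rewrite -(BCH (s2 x')) // -in_setC (subsetP KCH).
  by case/subsetP => y; rewrite inE y0A; case: ifP.
have sB : stable sigma B by rewrite stable_glue_sigma hB rB.
have TB := two_edge_connected_sub conn (in_setT z) sB aB (in_setT r) rB.
by apply/subsetP => y yH; rewrite BH // (subsetP TB).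
Qed.

Lemma two_edge_connected_glue_second : two_edge_connected setT sigma alpha ->
  two_edge_connected (~: V) s2 a2.
Proof.
move=> conn; apply: (two_edge_connected_from x'K) => z A zK sA aA x'A.
pose B := V :|: A.
have BK : {in ~: V, A =i B} by move=> y; rewrite [RHS]inE inE => /negPf->.
have VB y : y \in V -> y \in B by move=> yV; rewrite inE yV.
have constH : {in H &, forall u v, (u \in B) = (v \in B)}.
  by move=> u v uH vH; rewrite !VB ?setU1r.
have rB : r \in B by rewrite VB ?setU1r.
have xB : x \in B by rewrite VB ?setU11.
have x'B : x' \in B by rewrite -BK.
have hB : s2 x' \in B by rewrite -BK // (stableP _ _ sA).
have s2B := eq_in_stable s2K BK sA.
have sB : stable sigma B.
  rewrite stable_glue_sigma stable_glue_core hB rB xB VB ?setU1r //.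
  rewrite (stable_const s1H) //=.
  exact: cut_stable.
have aB : stable (cut alpha z) B.
  have a2B : stable (cut a2 z) B := eq_in_stable (perm_on_cut zK a2K) BK aA.
  have [zx'|zx'] := eqVneq z x'; last first.
    by rewrite stable_cut_glue_alpha_second // xB x'B (stable_const a1H).
  rewrite zx' stable_cut_glue_alpha_bridge ?set22 // (stable_const a1H) //.
  by rewrite zx' cut_id in a2B.
have TB := two_edge_connected_sub conn (in_setT z) sB aB (in_setT r) rB.
by apply/subsetP => y yK; rewrite BK // (subsetP TB).
Qed.

Lemma glue_core_first_side_stable : stable core V.
Proof.
rewrite stable_glue_core setU11 setU1r // eqxx /=.
rewrite perm_on_stable ?(perm_onS _ s1H) ?subsetUr //=.
by rewrite -stableC (perm_on_stable perm_on_glue_core_second).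
Qed.

Lemma cut_glue_alpha_first_side_stable : stable (cut alpha x) V.
Proof.
rewrite stable_cut_glue_alpha_bridge ?set21 //.
rewrite perm_on_stable ?(perm_onS _ a1H) ?subsetUr //=.
by rewrite -stableC perm_on_stable.
Qed.

Lemma glue_alpha_first_side y : y \in V -> (alpha y \in V) = (y != x).
Proof.
case/setU1P=> [->|yH].
  by rewrite glue_alpha_bridge eqxx; apply: negbTE; rewrite -in_setC.
by have /andP[-> _] := H_neq yH; rewrite glue_alpha_first // setU1r ?perm_closed.
Qed.

End GlueTheory.

Lemma glue_parts_inj (T : finType) (H : {set T}) x y s1 a1 r s2 a2 x' t1 b1 t2 b2 :
  gluable H x y s1 a1 r s2 a2 x' -> gluable H x y t1 b1 r t2 b2 x' ->
  s2 x' = t2 x' -> glue_core x y s1 s2 x' = glue_core x y t1 t2 x' ->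
  glue_alpha x a1 a2 x' = glue_alpha x b1 b2 x' ->
  [/\ s1 = t1, a1 = b1, s2 = t2 & a2 = b2].
Proof.
move=> G F Eh Ec Ea; have dis (A : {set T}) : [disjoint A & ~: A].
  by rewrite disjoints_subset setCK.
have [Es1 Es2] := perm_on_mul_inj (dis _)
  (perm_on_glue_core_first G) (perm_on_glue_core_second G)
  (perm_on_glue_core_first F) (perm_on_glue_core_second F) Ec.
have [_ _ /labelled_map_alpha_on a1H _] := and4P G.
have [_ _ /labelled_map_alpha_on b1H _] := and4P F.
have [Ea1 Ea2] := perm_on_mul_inj (dis _) a1H (perm_on_glue_alpha_second G)
  b1H (perm_on_glue_alpha_second F) Ea.
split=> //; [exact: mulgI Es1 | | exact: mulgI Ea2].
by move: Es2; rewrite /cut Eh => /mulgI.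
Qed.

Lemma glue_inj (T : finType) (H K : {set T}) x y s1 a1 r s2 a2 x' w v t1 b1 t2 b2 w' :
  gluable H x y s1 a1 r s2 a2 x' -> two_edge_connected H s1 a1 ->
  gluable K w v t1 b1 r t2 b2 w' -> two_edge_connected K t1 b1 ->
  glue_sigma x y s1 r s2 x' = glue_sigma w v t1 r t2 w' ->
  glue_alpha x a1 a2 x' = glue_alpha w b1 b2 w' ->
  [/\ H = K, x = w, y = v, x' = w' & [/\ s1 = t1, a1 = b1, s2 = t2 & a2 = b2]].
Proof.
move=> G connG F connF Es Ea.
have Eh : s2 x' = t2 w' by rewrite -(glue_sigma_root G) -(glue_sigma_root F) Es.
have Ec : glue_core x y s1 s2 x' = glue_core w v t1 t2 w'.
  by rewrite -(cut_glue_sigma G) -(cut_glue_sigma F) Es.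
have [xH _ /and3P[_ rH _] _] := and4P G; have [wK _ /and3P[_ rK _] _] := and4P F.
have EV : x |: H = w |: K.
  apply/eqP; rewrite eqEsubset; apply/andP; split.
    apply: (first_side_sub (z := w) G connG); rewrite ?Ec ?Ea ?setU1r //.
      exact: glue_core_first_side_stable F.
    exact: cut_glue_alpha_first_side_stable F.
  apply: (first_side_sub (z := x) F connF); rewrite -?Ec -?Ea ?setU1r //.
    exact: glue_core_first_side_stable G.
  exact: cut_glue_alpha_first_side_stable G.
have xw : x = w.
  apply/eqP; have := glue_alpha_first_side F (y := x); rewrite -EV setU11 => /(_ isT).
  by rewrite -Ea (glue_alpha_first_side G) ?setU11 // eqxx => /esym/negbFE.
subst w.
have HK : H = K by rewrite -(setU1K xH) EV (setU1K wK).
have xw' : x' = w' by rewrite -(glue_alpha_bridge G) Ea (glue_alpha_bridge F).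
have yv : y = v.
  apply: (@perm_inj _ (glue_core x y s1 s2 x')).
  by rewrite (glue_core_pred G) Ec (glue_core_pred F).
subst K w' v.
by split=> //; apply: glue_parts_inj G F Eh Ec Ea.
Qed.

(** * Cutting a bridgeless map *)

(* A union of sides, containing [r] but not [h], of the bridge deleted by [cut a z]. *)
Definition bridge_side (T : finType) (s a : {perm T}) (r h : T) : pred {set T} :=
  fun A => [&& stable s A, [exists z, stable (cut a z) A], r \in A & h \notin A].

Section Unglue.
Variables (T : finType) (s a : {perm T}) (r : T).
Hypotheses (M : labelled_map setT s a r) (conn : two_edge_connected setT s a).
Implicit Types (A : {set T}) (x z : T).

Let aK : involutive a := labelled_map_involutive M.
Let ar : a r = r := labelled_map_root M.

Lemma sigma_root_neq : 1 < #|T| -> s r != r.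
Proof.
move=> T1; apply: contraTneq T1 => sr; rewrite -leqNgt -cardsT -(cards1 r).
apply: subset_leq_card; apply: (two_edge_connected_sub conn (in_setT r) _ _ (in_setT r)).
- exact: stable_set1.
- by rewrite cut_id // stable_set1.
- exact: set11.
Qed.

Lemma bridge_sideC1 : s r != r -> bridge_side (cut s r) a r (s r) (~: [set s r]).
Proof.
move=> hr; rewrite /bridge_side !in_setC !in_set1 eqxx eq_sym hr /= andbT.
rewrite !stableC stable_set1 ?cut_fix //; apply/existsP; exists (s r).
by rewrite stableC stable_set1 // permM tpermL aK.
Qed.

Section MinimalSide.
Variable V : {set T}.
Hypothesis minV : minset (bridge_side (cut s r) a r (s r)) V.

Let cV : stable (cut s r) V. Proof. by have /and4P[] := minsetp minV. Qed.
Let rV : r \in V. Proof. by have /and4P[] := minsetp minV. Qed.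
Let hV : s r \notin V. Proof. by have /and4P[] := minsetp minV. Qed.

Lemma bridge_side_end : exists x, [/\ x \in V, a x \notin V & stable (cut a x) V].
Proof.
have /and4P[_ /existsP[z az] _ _] := minsetp minV.
have aVz : (a z \in V) != (z \in V).
  apply: contraNneq hV => Eaz; have aV : stable a V by rewrite (stable_cut a z) Eaz eqxx.
  by rewrite (two_edge_connected_detach M conn cV aV).
have [zV|zV] := boolP (z \in V).
  by exists z; rewrite zV in aVz; split; case: (a z \in V) aVz.
exists (a z); rewrite aK; split=> //.
  by case: (a z \in V) aVz; rewrite (negPf zV).
by rewrite /cut aK tpermC.
Qed.

Section BridgeEnd.
Variable x : T.
Hypotheses (xV : x \in V) (axV : a x \notin V) (aV : stable (cut a x) V).

Let xr : x != r. Proof. by apply: contraNneq axV => ->; rewrite ar. Qed.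

Lemma bridge_end_not_fixed : cut s r x != x.
Proof.
apply/eqP => cx; have := two_edge_connected_detach M conn (A := V :\ x).
rewrite !in_setD1 (negPf hV) andbF eq_sym xr rV => /(_ (stableD1 cx cV)).
suff aVx : stable a (V :\ x) by move/(_ aVx).
rewrite (stable_cut a x) !in_setD1 eqxx (negPf axV) andbF /=.
by apply: stableD1; rewrite // permM tpermL aK.
Qed.

Local Notation y := ((cut s r)^-1 x)%g.
Local Notation scut := (cut (cut s r) y).
Local Notation acut := (cut a x).
Local Notation s1 := (restr_perm V scut).
Local Notation a1 := (restr_perm V acut).
Local Notation s2 := (insert (s r) (a x) (restr_perm (~: V) scut)).
Local Notation a2 := (restr_perm (~: V) acut).

Let cut_y : cut s r y = x. Proof. exact: permKV. Qed.
Let yV : y \in V. Proof. by rewrite -(stableP _ _ cV) cut_y. Qed.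
Let yx : y != x.
Proof. by apply: contraNneq bridge_end_not_fixed => yx; rewrite -{1}yx cut_y. Qed.
Let scut_x : scut x = x.
Proof. by have := cut_fix (cut s r) y; rewrite cut_y. Qed.
Let scut_h : scut (s r) = s r.
Proof.
have hx : s r != x by apply: contraNneq hV => ->.
rewrite cut_neq ?cut_y ?cut_fix //; apply: contraNneq hV => ->; exact: yV.
Qed.
Let scutV : stable scut V. Proof. exact: cut_stable. Qed.
Let acut_x : acut x = x. Proof. by rewrite permM tpermL aK. Qed.
Let acut_fixing : fixing_involution (x |: (a x |: [set r])) acut.
Proof.
have /and3P[_ _] := M; rewrite setCT setU0; exact: fixing_involution_cut.
Qed.
Let s2_end : s2 (a x) = s r.
Proof. by apply: insertE; rewrite restr_permE_if ?stableC // scut_h if_same. Qed.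
Let cut_s2 : cut s2 (a x) = restr_perm (~: V) scut.
Proof. by apply: cut_insert; rewrite restr_permE_if ?stableC // scut_h if_same. Qed.

Lemma unglue_gluable : gluable (V :\ x) x y s1 a1 r s2 a2 (a x).
Proof.
rewrite /gluable setD1K // in_setD1 eqxx in_setD1 yx yV /=; apply/andP; split.
  apply/and3P; split; rewrite ?perm_on_restr_permD1 ?in_setD1 1?eq_sym ?xr //.
  suff <- : x |: (a x |: [set r]) :|: ~: V = r |: ~: (V :\ x).
    exact: fixing_involution_restr.
  apply/setP => z; rewrite !inE; have [->|zx] /= := eqVneq z x; first by rewrite orbT.
  by have [->|zax] //= := eqVneq z (a x); rewrite axV orbT.
apply/and3P; split; rewrite ?in_setC //.
  by apply: perm_on_insert; rewrite ?restr_perm_on ?in_setC.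
suff <- : x |: (a x |: [set r]) :|: ~: ~: V = a x |: ~: ~: V.
  by apply: fixing_involution_restr; rewrite ?stableC.
apply/setP => z; rewrite !inE negbK.
have [->|zx] /= := eqVneq z x; first by rewrite xV orbT.
by have [->|zr] := eqVneq z r; rewrite ?rV ?orbT ?orbF.
Qed.

Lemma unglue_core : glue_core x y s1 s2 (a x) = cut s r.
Proof.
rewrite /glue_core cut_s2 /insert -mulgA restr_permM_setC //.
by rewrite -[RHS](insert_cut _ y) cut_y.
Qed.

Lemma unglue_sigma : glue_sigma x y s1 r s2 (a x) = s.
Proof. by rewrite /glue_sigma s2_end unglue_core insert_cut. Qed.

Lemma unglue_alpha : glue_alpha x a1 a2 (a x) = a.
Proof.
have xax_on := tperm_on (a x) x; have a1_on := perm_on_restr_permD1 acut_x aV.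
rewrite /glue_alpha /insert mulgA (perm_onC a1_on xax_on) -?mulgA.
  by rewrite restr_permM_setC // tpermC tpermKg.
by rewrite disjoint_sym disjoints_subset subUset !sub1set !inE eqxx (negPf axV) andbF.
Qed.

Lemma unglue_first_two_edge_connected : two_edge_connected (V :\ x) s1 a1.
Proof.
apply: (two_edge_connected_glue_first unglue_gluable).
  by rewrite unglue_sigma unglue_alpha.
rewrite unglue_core unglue_alpha s2_end => z A cA aA rA hA; apply/negP => AV.
have AE : A = V.
  apply: (minsetinf minV); last exact: subset_trans AV (subsetDl _ _).
  by apply/and4P; split=> //; apply/existsP; exists z.
by have := subsetP AV x; rewrite AE xV !inE eqxx => /(_ isT).
Qed.

Lemma unglue_second_two_edge_connected : two_edge_connected (~: (x |: V :\ x)) s2 a2.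
Proof.
apply: (two_edge_connected_glue_second unglue_gluable).
by rewrite unglue_sigma unglue_alpha.
Qed.

End BridgeEnd.
End MinimalSide.

Lemma glue_surj : 1 < #|T| -> exists H x y s1 a1 s2 a2 x',
  [/\ gluable H x y s1 a1 r s2 a2 x', two_edge_connected H s1 a1,
      two_edge_connected (~: (x |: H)) s2 a2,
      s = glue_sigma x y s1 r s2 x' & a = glue_alpha x a1 a2 x'].
Proof.
move=> /sigma_root_neq/bridge_sideC1 sideC1.
have [V minV _] := minset_exists sideC1.
have [x [xV axV aV]] := bridge_side_end minV.
do 8 eexists; split.
- exact: (unglue_gluable minV xV axV aV).
- exact: unglue_first_two_edge_connected.
- exact: unglue_second_two_edge_connected.
- by rewrite unglue_sigma.
- by rewrite unglue_alpha.
Qed.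

End Unglue.

(** * Extension of permutations along an injection *)

Section ExtPerm.
Variables (S T : finType) (f : S -> T).
Hypothesis fI : injective f.
Implicit Types (s a : {perm S}) (A Z : {set T}) (x : S) (y : T).

Definition ext_fun s y := if [pick x | f x == y] is Some x then f (s x) else y.

Lemma ext_funE s x : ext_fun s (f x) = f (s x).
Proof.
rewrite /ext_fun; case: pickP => [z /eqP/fI -> //|/(_ x)].
by rewrite eqxx.
Qed.

Lemma ext_fun_out s y : y \notin f @: setT -> ext_fun s y = y.
Proof. by rewrite /ext_fun; case: pickP => // x /eqP <-; rewrite imset_f. Qed.

Lemma ext_fun_inj s : injective (ext_fun s).
Proof.
move=> y z.
have [/imsetP[u _ ->]|yf] := boolP (y \in f @: setT);
have [/imsetP[v _ ->]|zf] := boolP (z \in f @: setT).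
- by rewrite !ext_funE => /fI/perm_inj->.
- by rewrite ext_funE ext_fun_out // => E; rewrite -E imset_f in zf.
- by rewrite ext_fun_out // ext_funE => E; rewrite E imset_f in yf.
- by rewrite !ext_fun_out.
Qed.

Definition ext_perm s : {perm T} := perm (@ext_fun_inj s).

Lemma ext_permE s x : ext_perm s (f x) = f (s x).
Proof. by rewrite permE ext_funE. Qed.

Lemma ext_perm_out s y : y \notin f @: setT -> ext_perm s y = y.
Proof. by move=> yf; rewrite permE ext_fun_out. Qed.

Lemma ext_perm_on s : perm_on (f @: setT) (ext_perm s).
Proof. by apply/subsetP => y; rewrite inE; apply: contraR => /ext_perm_out->. Qed.

Lemma ext_perm_inj : injective ext_perm.
Proof. by move=> s t st; apply/permP => x; apply: fI; rewrite -!ext_permE st. Qed.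

Lemma ext_perm_surj p : perm_on (f @: setT) p -> exists s, p = ext_perm s.
Proof.
move=> pf; have im_sub : [set ext_perm s | s in setT] \subset perm_on (f @: setT).
  by apply/subsetP => _ /imsetP[s _ ->]; apply: ext_perm_on.
have card_im : #|[set ext_perm s | s in setT]| = #|perm_on (f @: setT)|.
  rewrite (card_imset _ ext_perm_inj) card_perm card_imset // -(card_perm [set: S]).
  by rewrite cardsT; apply/esym/eq_card => s; apply/subsetP => x; rewrite inE.
by have := subset_cardP card_im im_sub p; rewrite [RHS]pf => /imsetP[s _ ->]; exists s.
Qed.

Lemma stable_ext_perm s A : stable (ext_perm s) A = stable s (f @^-1: A).
Proof.
apply/stableP/stableP => sA y; first by rewrite !inE -ext_permE.
have [/imsetP[x _ ->]|yf] := boolP (y \in f @: setT); last by rewrite ext_perm_out.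
by have := sA x; rewrite !inE ext_permE.
Qed.

Lemma cut_ext_perm s x : cut (ext_perm s) (f x) = ext_perm (cut s x).
Proof.
apply/permP => y; have [/imsetP[z _ ->]|yf] := boolP (y \in f @: setT); last first.
  rewrite [RHS]ext_perm_out // permM ext_permE tpermD ?ext_perm_out //.
    by apply: contraNneq yf => <-; rewrite imset_f.
  by apply: contraNneq yf => <-; rewrite imset_f.
by rewrite ext_permE !permM ext_permE -inj_tperm // ext_permE.
Qed.

Lemma fixing_involution_ext a Z : ~: (f @: setT) \subset Z ->
  fixing_involution Z (ext_perm a) = fixing_involution (f @^-1: Z) a.
Proof.
move=> /subsetP fZ; apply/fixing_involutionP/fixing_involutionP => -[aK aZ].
  split=> x; first by apply: fI; rewrite -!ext_permE aK.
  by rewrite inE -aZ ext_permE (inj_eq fI).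
split=> y; (have [/imsetP[x _ ->]|yf] := boolP (y \in f @: setT); last first).
- by rewrite !ext_perm_out.
- by rewrite !ext_permE aK.
- by rewrite ext_perm_out // eqxx fZ // inE.
by rewrite ext_permE (inj_eq fI) aZ inE.
Qed.

End ExtPerm.

Section LabelledMapsExt.
Variables (S T : finType) (f : S -> T) (fI : injective f).
Implicit Types (s a : {perm S}) (r : S).

Lemma labelled_map_ext s a r :
  labelled_map (f @: setT) (ext_perm fI s) (ext_perm fI a) (f r) =
  labelled_map setT s a r.
Proof.
rewrite /labelled_map ext_perm_on imset_f ?inE //= fixing_involution_ext ?subsetUr //.
rewrite (_ : perm_on setT s); last by apply/subsetP => x; rewrite inE.
congr (fixing_involution _ a); apply/setP => x.
by rewrite !inE (inj_eq fI) imset_f.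
Qed.

Lemma two_edge_connected_ext s a :
  two_edge_connected (f @: setT) (ext_perm fI s) (ext_perm fI a) =
  two_edge_connected setT s a.
Proof.
have edgeE x : inseparable (jointly_stable (ext_perm fI s) (cut (ext_perm fI a) (f x)))
    (f @: setT) = inseparable (jointly_stable s (cut a x)) setT.
  apply: inseparable_imset => // A.
  by rewrite /jointly_stable cut_ext_perm !stable_ext_perm.
apply/forall_inP/forall_inP => conn.
  by move=> x _; rewrite -edgeE conn ?imset_f.
by move=> _ /imsetP[x _ ->]; rewrite edgeE conn.
Qed.

Lemma bridgeless_labelled_maps_imset :
  bridgeless_labelled_maps (f @: setT) =
  [set (ext_perm fI M.1.1, ext_perm fI M.1.2, f M.2)
     | M in bridgeless_labelled_maps [set: S]].
Proof.
apply/setP => -[[p q] t]; apply/idP/imsetP => [|[[[s a] r]]]; rewrite inE /=; last first.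
  by move=> Msar [-> -> ->]; rewrite inE labelled_map_ext two_edge_connected_ext.
move=> Mpqt; have /andP[Lpqt _] := Mpqt; have /and3P[pf tf _] := Lpqt.
have [s ps] := ext_perm_surj fI pf.
have [a qa] := ext_perm_surj fI (labelled_map_alpha_on Lpqt).
case/imsetP: tf => r _ tr; subst p q t.
by exists (s, a, r) => //; rewrite inE -labelled_map_ext -two_edge_connected_ext.
Qed.

Lemma card_bridgeless_labelled_maps_imset :
  #|bridgeless_labelled_maps (f @: setT)| = #|bridgeless_labelled_maps [set: S]|.
Proof.
rewrite bridgeless_labelled_maps_imset card_imset // => -[[s a] r] [[t b] u] [/=].
by move=> /ext_perm_inj-> /ext_perm_inj-> /fI->.
Qed.

End LabelledMapsExt.

(** * Counting labelled bridgeless maps *)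

Definition num_bridgeless_labelled_maps k := #|bridgeless_labelled_maps [set: 'I_k]|.

Lemma card_bridgeless_labelled_maps (T : finType) (H : {set T}) :
  #|bridgeless_labelled_maps H| = num_bridgeless_labelled_maps #|H|.
Proof.
have := card_bridgeless_labelled_maps_imset (@enum_val_inj T (mem H)).
by rewrite imset_enum_val.
Qed.

Lemma num_bridgeless_labelled_maps0 : num_bridgeless_labelled_maps 0 = 0.
Proof. by apply: eq_card0 => -[[s a] []]. Qed.

Lemma num_bridgeless_labelled_maps1 : num_bridgeless_labelled_maps 1 = 1.
Proof.
have perm1E (s : {perm 'I_1}) : s = 1%g by apply/permP => x; rewrite !ord1.
transitivity #|[set (1%g : {perm 'I_1}, 1%g : {perm 'I_1}, ord0 : 'I_1)]|;
  last by rewrite cards1.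
apply: eq_card => -[[s a] r]; rewrite [s]perm1E [a]perm1E [r]ord1 in_set1 eqxx inE /=.
apply/andP; split.
  apply/and3P; split; rewrite ?perm_on1 ?inE //.
  by apply/fixing_involutionP; split=> y; rewrite !perm1 // !ord1 eqxx !inE.
by apply/(two_edge_connected_from (in_setT ord0)) => x A _ _ _ A0;
  apply/subsetP => y _; rewrite ord1.
Qed.

Section CountGluings.
Variable T : finType.
Local Notation lmap := ({perm T} * {perm T} * T)%type.
Local Notation gluing := (({set T} * T) * (lmap * T * lmap))%type.

Definition gluing_parts (p : {set T} * T) : {set lmap * T * lmap} :=
  setX (setX (bridgeless_labelled_maps p.1) p.1)
       (bridgeless_labelled_maps (~: (p.2 |: p.1))).

Definition gluings : {set gluing} :=
  [set q : gluing | (q.1.2 \notin q.1.1) && (q.2 \in gluing_parts q.1)].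

Definition glue (q : gluing) : lmap :=
  let: ((_, x), ((s1, a1, r), y, (s2, a2, x'))) := q in
  (glue_sigma x y s1 r s2 x', glue_alpha x a1 a2 x', r).

Lemma gluingsP H x s1 a1 r y s2 a2 x' :
  reflect [/\ gluable H x y s1 a1 r s2 a2 x', two_edge_connected H s1 a1 &
              two_edge_connected (~: (x |: H)) s2 a2]
    (((H, x), ((s1, a1, r), y, (s2, a2, x'))) \in gluings).
Proof.
rewrite inE !in_setX !inE /=; apply: (iffP andP).
  by case=> xH /andP[/andP[/andP[M1 ?] yH] /andP[M2 ?]]; split=> //; apply/and4P.
by case=> /and4P[-> -> -> ->] -> ->.
Qed.

Lemma glue_gluings :
  1 < #|T| -> glue @: gluings = bridgeless_labelled_maps [set: T].
Proof.
move=> T1; apply/esym/setP => -[[s a] r]; apply/idP/imsetP.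
  rewrite inE => /andP[/= M conn].
  have [H [x [y [s1 [a1 [s2 [a2 [x' [G conn1 conn2 -> ->]]]]]]]]] := glue_surj M conn T1.
  by exists ((H, x), ((s1, a1, r), y, (s2, a2, x'))) => //; apply/gluingsP.
move=> [[[H x] [[[[s1 a1] t] y] [[s2 a2] x']]] /gluingsP[G conn1 conn2] [-> -> ->]].
rewrite inE /= (glue_labelled_map G); exact: glue_two_edge_connected G conn1 conn2.
Qed.

Lemma glue_gluings_inj : {in gluings &, injective glue}.
Proof.
move=> [[H x] [[[[s1 a1] r] y] [[s2 a2] x']]].
move=> [[K w] [[[[t1 b1] u] v] [[t2 b2] w']]].
move=> /gluingsP[G connG _] /gluingsP[F connF _] [Es Ea Er]; subst u.
by have [-> -> -> -> [-> -> -> ->]] := glue_inj G connG F connF Es Ea.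
Qed.

Lemma card_gluings : #|gluings| = \sum_(p : {set T} * T | p.2 \notin p.1)
  #|bridgeless_labelled_maps p.1| * #|p.1| *
  #|bridgeless_labelled_maps (~: (p.2 |: p.1))|.
Proof.
transitivity (\sum_(p : {set T} * T | p.2 \notin p.1) #|gluing_parts p|).
  exact: card_dep_pairs.
by apply: eq_bigr => p _; rewrite !cardsX.
Qed.

End CountGluings.

Lemma num_bridgeless_labelled_maps_rec N : 1 < N ->
  num_bridgeless_labelled_maps N = \sum_(j < N)
    'C(N, j) * (N - j) * j *
    num_bridgeless_labelled_maps j * num_bridgeless_labelled_maps (N.-1 - j).
Proof.
move=> N1; pose F j :=
  j * num_bridgeless_labelled_maps j * num_bridgeless_labelled_maps (N.-1 - j).
rewrite /num_bridgeless_labelled_maps -glue_gluings ?card_ord //.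
rewrite (card_in_imset (@glue_gluings_inj _)) card_gluings.
transitivity (\sum_(H : {set 'I_N}) \sum_(x in ~: H) F #|H|).
  rewrite pair_big_dep; apply: eq_big => -[H x]; rewrite ?inE //= => xH.
  rewrite !card_bridgeless_labelled_maps [#|~: _|]cardsCs setCK cardsU1 xH card_ord.
  by rewrite /F [num_bridgeless_labelled_maps _ * _]mulnC subnDA subn1.
transitivity (\sum_(H : {set 'I_N}) (N - #|H|) * F #|H|).
  by apply: eq_bigr => H _; rewrite sum_nat_const cardsCs setCK card_ord.
rewrite (sum_card_sets _ (fun j => (N - j) * F j)) card_ord big_ord_recr /=.
rewrite subnn muln0 addn0.
by apply: eq_bigr => j _; rewrite /F !mulnA.
Qed.

(** * From labelled maps to isomorphism classes *)

Section LabelledMapsOrd.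
Variable k : nat.
Implicit Types (s a f g : {perm 'I_k}) (A : {set 'I_k}) (M : rmap k).

Lemma adj_minus_closed s a r x A : stable s A -> stable (cut a x) A ->
  closed (adj_minus (s, a, r) (medge (s, a, r) x)) [pred u : {set 'I_k} | u \subset A].
Proof.
move=> sA aA u v /existsP[h /and3P[/eqP-> /eqP-> hx]].
rewrite !inE !porbit_sub_stable //=.
rewrite -(stableP _ _ aA h) cut_neq //; apply: contraNneq hx => ->.
  by [].
by rewrite eq_porbit_mem (mem_porbit a 1).
Qed.

Lemma bridgeless_two_edge_connected s a r :
  bridgeless (s, a, r) -> two_edge_connected setT s a.
Proof.
move=> /forall_inP no_bridge; apply/forall_inP => x _; apply/inseparableP => A.
case/andP=> sA aA y z _ _; rewrite -!(porbit_sub_stable _ sA).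
have xe : medge (s, a, r) x \in medges (s, a, r) by rewrite imset_f.
have vV h : porbit s h \in mvertices (s, a, r).
  by apply: (imset_f (mvertex (s, a, r))); rewrite inE.
have := no_bridge _ xe; rewrite /is_bridge xe negbK.
move=> /forall_inP/(_ _ (vV y))/forall_inP/(_ _ (vV z)).
exact: (closed_connect (adj_minus_closed sA aA)).
Qed.

Lemma two_edge_connected_bridgeless s a r :
  involutive a -> two_edge_connected setT s a -> bridgeless (s, a, r).
Proof.
move=> aK /forall_inP conn; apply/forall_inP => _ /imsetP[x _ ->].
rewrite /is_bridge negb_and negbK; apply/orP; right.
apply/forall_inP => _ /imsetP[g _ ->]; apply/forall_inP => _ /imsetP[h _ ->].
set e := adj_minus _ _; pose A := [set y | connect e (porbit s g) (porbit s y)].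
suff PA : jointly_stable s (cut a x) A.
  have := inseparableP _ _ (conn x (in_setT x)) A PA g h (in_setT g) (in_setT h).
  by rewrite !inE connect0.
apply/andP; split; first by apply/stableP => y; rewrite !inE (porbit_perm s 1).
apply: (stable_involutive (cut_involutive x aK)) => y.
rewrite !inE (cut_involE _ _ aK); case: ifPn => // yx gy.
apply: connect_trans gy (connect1 _); apply/existsP; exists y; rewrite !eqxx /=.
by rewrite eq_porbit_mem (porbit_involutive _ aK).
Qed.

Lemma labelled_map_orbit s a r h : labelled_map setT s a r ->
  two_edge_connected setT s a -> orbit 'P%act <<[set s; a]>>%g h = setT.
Proof.
move=> M conn; apply/eqP; rewrite -subTset.
have acts_orb := acts_orbit 'P h (subsetT <<[set s; a]>>%g).
apply: (two_edge_connected_sub conn (in_setT r) _ _ (in_setT h) (orbit_refl _ _ _)).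
  by rewrite (subsetP acts_orb) // mem_gen // set21.
by apply: cut_stable; rewrite (subsetP acts_orb) // mem_gen // set22.
Qed.

Lemma bridgeless_mapsE : bridgeless_maps k = bridgeless_labelled_maps [set: 'I_k].
Proof.
apply/setP => -[[s a] r]; rewrite !inE; apply/andP/andP => /= [[]|[M conn]].
  case/andP=> /andP[/forallP /= aK /forallP /= afix] _ /bridgeless_two_edge_connected.
  split=> //; apply/and3P; split; rewrite ?inE //.
    by apply/subsetP => y; rewrite inE.
  apply/fixing_involutionP; split=> y; first exact/eqP.
  by rewrite (eqP (afix y)) !inE orbF.
have aK := labelled_map_involutive M; split; last exact: two_edge_connected_bridgeless.
rewrite /is_closed_rmap -andbA; apply/and3P; split; apply/forallP => y.
- by rewrite aK.
- by rewrite (labelled_map_fix M) ?inE.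
by rewrite (labelled_map_orbit _ M conn).
Qed.

Definition map_conj f M : rmap k := ((M.1.1 ^ f)%g, (M.1.2 ^ f)%g, f M.2).

Lemma map_conj1 M : map_conj 1%g M = M.
Proof. by case: M => [[s a] r]; rewrite /map_conj /= !conjg1 perm1. Qed.

Lemma map_conjM f g M : map_conj (f * g)%g M = map_conj g (map_conj f M).
Proof. by rewrite /map_conj /= !conjgM permM. Qed.

Lemma rmap_isoP M M' : reflect (exists f, M' = map_conj f M) (rmap_iso M M').
Proof.
apply: (iffP existsP) => -[f]; last first.
  by move=> ->; exists f; rewrite eqxx andbT; apply/andP; split;
    apply/forallP => y; rewrite permJ.
case: M M' => [[s a] r] [[s' a'] r'] /andP[/andP[/forallP fs /forallP fa] /eqP fr].
exists f; congr (_, _, _) => //; apply/permP => y; rewrite -[y](permKV f) permJ.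
  exact/esym/eqP/fs.
exact/esym/eqP/fa.
Qed.

Lemma rmap_iso_equivalence : equivalence_rel (@rmap_iso k).
Proof.
move=> M M' M''; split; first by apply/rmap_isoP; exists 1%g; rewrite map_conj1.
case/rmap_isoP=> f ->; apply/rmap_isoP/rmap_isoP => -[g ->].
  by exists (f^-1 * g)%g; rewrite -map_conjM mulKVg.
by exists (f * g)%g; rewrite map_conjM.
Qed.

Lemma bridgeless_labelled_maps_conj f M :
  M \in bridgeless_labelled_maps setT -> map_conj f M \in bridgeless_labelled_maps setT.
Proof.
move=> ML; have <- : f @: setT = setT.
  by apply/setP => y; rewrite inE -[y](permKV f) imset_f ?inE.
rewrite (bridgeless_labelled_maps_imset perm_inj); apply/imsetP; exists M => //.
by rewrite /map_conj; congr (_, _, _); apply/permP => y;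
  rewrite -[y](permKV f) permJ ext_permE.
Qed.

(* Rooted maps are rigid: the half-edges on which two isomorphisms agree form a stable
   set containing the root. *)
Lemma map_conj_inj M :
  M \in bridgeless_labelled_maps setT -> injective (map_conj^~ M).
Proof.
case: M => [[s a] r]; rewrite inE => /andP[/= L conn] f g [Es Ea Er].
pose A := [set y | f y == g y].
have agree (t : {perm 'I_k}) : (t ^ f = t ^ g)%g -> stable t A.
  move=> Et; apply/stableP => y; rewrite !inE -permJ -[g (t y)]permJ -Et.
  by rewrite (inj_eq perm_inj).
have rA : r \in A by rewrite inE Er.
have TA := two_edge_connected_sub conn (in_setT r) (agree s Es)
  (cut_stable _ (agree a Ea)) (in_setT r) rA.
by apply/permP => y; have := subsetP TA y (in_setT y); rewrite inE => /eqP.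
Qed.

Lemma num_bridgeless_labelled_maps_classes :
  num_bridgeless_labelled_maps k = num_bridgeless_classes k * k`!.
Proof.
rewrite /num_bridgeless_labelled_maps /num_bridgeless_classes bridgeless_mapsE.
have isoE : {in bridgeless_labelled_maps setT & &, equivalence_rel (@rmap_iso k)}.
  by move=> * ; apply: rmap_iso_equivalence.
apply: (card_uniform_partition _ (equivalence_partitionP isoE)).
move=> _ /imsetP[M ML ->].
transitivity #|[set map_conj f M | f in [set: {perm 'I_k}]]|.
  apply: eq_card => M'; rewrite inE; apply/andP/imsetP => [[_ /rmap_isoP[f ->]]|[f _ ->]].
    by exists f.
  by split; [apply: bridgeless_labelled_maps_conj | apply/rmap_isoP; exists f].
by rewrite card_imset ?cardsT ?card_Sn //; apply: map_conj_inj.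
Qed.

End LabelledMapsOrd.

(** * Connected chord diagrams as involutions *)

Section ChordDiagrams.
Variable m : nat.
Implicit Types (a b : {perm 'I_m}) (A B S : {set 'I_m}) (u v x y : 'I_m).

Definition crosses a : rel 'I_m := fun u v => [&& u < v, v < a u & a u < a v].

Definition chord_closed a : pred {set 'I_m} := fun A =>
  stable a A && [forall u, forall v, crosses a u v ==> ((u \in A) == (v \in A))].

(* The diagram with endpoints [S] in which [a] exchanges the ends of each chord. *)
Definition connected_involution S a :=
  fixing_involution (~: S) a && inseparable (chord_closed a) S.

Definition connected_involutions S := [set a | connected_involution S a].

Lemma chord_closedP a A :
  reflect (stable a A /\ closed (crosses a) A) (chord_closed a A).
Proof.
apply: (iffP andP) => -[sA cA]; split=> //.
  by move=> u v uv; have /forallP/(_ u)/forallP/(_ v) := cA; rewrite uv => /eqP.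
by apply/forallP => u; apply/forallP => v; apply/implyP => /cA->.
Qed.

Lemma chord_closedT a : chord_closed a setT.
Proof. by apply/chord_closedP; split=> [|u v _]; [apply/stableP => y|]; rewrite !inE. Qed.

Lemma chord_closedC a A : chord_closed a A -> chord_closed a (~: A).
Proof.
case/chord_closedP=> sA cA; apply/chord_closedP; split=> [|u v uv].
  by rewrite stableC.
by rewrite !inE (cA u v).
Qed.

Lemma chord_closedI a A B :
  chord_closed a A -> chord_closed a B -> chord_closed a (A :&: B).
Proof.
case/chord_closedP=> sA cA /chord_closedP[sB cB]; apply/chord_closedP.
by split=> [|u v uv]; [apply: stableI | rewrite !inE (cA u v) // (cB u v)].
Qed.

Lemma crosses_on S a u v : perm_on S a -> crosses a u v -> (u \in S) && (v \in S).
Proof.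
move=> aS /and3P[uv vau auav]; apply/andP; split; apply: contraT => nS.
  by move: vau; rewrite (out_perm aS nS); lia.
by move: auav; rewrite (out_perm aS nS); lia.
Qed.

Lemma chord_closed_restrict S a b A :
  perm_on S b -> {in S, b =1 a} -> chord_closed a A -> chord_closed b A.
Proof.
move=> bS ab /chord_closedP[sA cA]; apply/chord_closedP; split=> [|u v uv].
  apply/stableP => y; have [yS|yS] := boolP (y \in S); last by rewrite (out_perm bS).
  by rewrite ab // (stableP _ _ sA).
have /andP[uS vS] := crosses_on bS uv.
by apply: cA; rewrite /crosses -!ab.
Qed.

Lemma chord_closed_extend S a b A : {in S, b =1 a} -> chord_closed a S ->
  chord_closed b A -> chord_closed a (A :&: S).
Proof.
move=> ab /chord_closedP[sS cS] /chord_closedP[sA cA]; apply/chord_closedP.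
split=> [|u v uv].
  apply/stableP => y; rewrite !inE (stableP _ _ sS).
  by have [yS|] := boolP (y \in S); rewrite ?andbF // -ab // (stableP _ _ sA).
rewrite !inE (cS u v) //; have [vS|] := boolP (v \in S); last by rewrite !andbF.
by rewrite (cA u v) // /crosses !ab // (cS u v).
Qed.

Lemma connected_involution_involutive S a : connected_involution S a -> involutive a.
Proof. by case/andP=> /fixing_involutionP[]. Qed.

Lemma connected_involution_on S a : connected_involution S a -> perm_on S a.
Proof. by case/andP=> F _; apply: fixing_involution_on F _. Qed.

Lemma connected_involution_neq S a y : connected_involution S a -> y \in S -> a y != y.
Proof. by case/andP=> /fixing_involutionP[_ ->] _; rewrite inE negbK. Qed.

Lemma connected_involution_sub S a A y :
  connected_involution S a -> chord_closed a A -> y \in S -> y \in A -> S \subset A.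
Proof. by case/andP=> _; apply: inseparable_sub. Qed.

End ChordDiagrams.

Lemma chord_closed_ext m n (f : 'I_m -> 'I_n) (fI : injective f)
    (a : {perm 'I_m}) (A : {set 'I_n}) :
  (forall x y, (f x < f y) = (x < y)) ->
  chord_closed (ext_perm fI a) A = chord_closed a (f @^-1: A).
Proof.
move=> f_mono; rewrite /chord_closed stable_ext_perm; congr (_ && _).
apply/'forall_forallP/'forall_forallP => cA u v; apply/implyP.
  by have /implyP := cA (f u) (f v); rewrite /crosses !ext_permE !f_mono !inE.
move=> uv; have := uv.
have /andP[/imsetP[x _ ->] /imsetP[y _ ->]] := crosses_on (ext_perm_on fI a) uv.
by have /implyP := cA x y; rewrite /crosses !ext_permE !f_mono !inE.
Qed.

Lemma connected_involutions_imset m n (f : 'I_m -> 'I_n) (fI : injective f) :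
  (forall x y, (f x < f y) = (x < y)) ->
  connected_involutions (f @: setT) = ext_perm fI @: connected_involutions setT.
Proof.
move=> f_mono.
have extE a :
    connected_involution (f @: setT) (ext_perm fI a) = connected_involution setT a.
  rewrite /connected_involution fixing_involution_ext ?subxx //.
  congr (fixing_involution _ a && _).
    by apply/setP => x; rewrite !inE imset_f.
  by apply: inseparable_imset => // A; apply: chord_closed_ext.
apply/setP => p; rewrite inE; apply/idP/imsetP => [pD|[a]]; last first.
  by rewrite inE -extE => aD ->.
have [a pa] := ext_perm_surj fI (connected_involution_on pD).
by exists a; rewrite // inE -extE -pa.
Qed.

Definition num_connected_involutions k := #|connected_involutions [set: 'I_k]|.

Lemma card_connected_involutions m (S : {set 'I_m}) :
  #|connected_involutions S| = num_connected_involutions #|S|.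
Proof.
pose f : 'I_#|S| -> 'I_m := Order.enum_val.
have fI : injective f by apply: Order.enum_val_inj.
have f_le x y : (f x <= f y) = (x <= y).
  exact: (Order.le_enum_val (T := 'I_m) (fun u v => leq_total u v)).
have f_lt x y : (f x < f y) = (x < y) by rewrite !ltnNge f_le.
rewrite /num_connected_involutions -(card_imset _ (@ext_perm_inj _ _ f fI)).
rewrite -connected_involutions_imset //; congr #|pred_of_set (connected_involutions _)|.
apply/setP => x; apply/idP/imsetP => [xS|[i _ ->]]; last exact: Order.enum_valP.
by exists (Order.enum_rank_in xS x); rewrite /f ?Order.enum_rankK_in.
Qed.

Lemma num_connected_involutions1 : num_connected_involutions 1 = 0.
Proof.
apply: eq_card0 => a; rewrite inE; apply/negP => aD.
by have := connected_involution_neq aD (in_setT ord0); rewrite [a _]ord1 eqxx.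
Qed.

Lemma num_connected_involutions2 : num_connected_involutions 2 = 1.
Proof.
have ord2 (x : 'I_2) : x = ord0 \/ x = ord_max.
  by case: x => -[|[|//]] lt2; [left|right]; apply/val_inj.
transitivity #|[set tperm (ord0 : 'I_2) ord_max]|; last by rewrite cards1.
apply: eq_card => a; rewrite inE in_set1; apply/idP/eqP => [aD|->].
  have a0 : a ord0 = ord_max.
    by have := connected_involution_neq aD (in_setT ord0); case: (ord2 (a ord0)) => ->.
  have a1 : a ord_max = ord0 by rewrite -a0 (connected_involution_involutive aD).
  by apply/permP => x; case: (ord2 x) => ->; rewrite ?tpermL ?tpermR.
apply/andP; split.
  apply/fixing_involutionP; split=> y; first by rewrite tpermK.
  by rewrite !inE; case: (ord2 y) => ->; rewrite ?tpermL ?tpermR.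
apply/inseparableP => A /chord_closedP[/stableP sA _] x y _ _.
have := sA ord0; rewrite tpermL => A01.
by case: (ord2 x) => ->; case: (ord2 y) => ->.
Qed.

(** * Inserting a diagram into a gap *)

(* The endpoints of a component that leaves only the gap between [i] and [j] for
   the other ends of the diagram, apart from the root [0]. *)
Definition gapset m (i j : nat) : {set 'I_m.+1} :=
  [set p : 'I_m.+1 | (0 < p <= i) || (j <= p)].

Lemma card_gapsetC m i j : i < j <= m -> #|~: gapset m i j| = j - i.
Proof.
case/andP=> ij jm; have -> : ~: gapset m i j = ord0 |: [set p : 'I_m.+1 | i.+1 <= p < j].
  by apply/setP => p; rewrite !inE -val_eqE /=; lia.
by rewrite cardsU1 card_ord_itv 1?ltnW // inE /=; lia.
Qed.

Lemma card_gapset m i j : i < j <= m -> #|gapset m i j| = i + (m.+1 - j).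
Proof. by move=> ijm; rewrite cardsCs card_gapsetC // card_ord; lia. Qed.

Lemma gapset_inj m i j i' j' b : i < b < j -> i' < b < j' ->
  j <= m -> j' <= m -> gapset m i j = gapset m i' j' -> i = i' /\ j = j'.
Proof.
move=> ib ib' jm jm' /setP E.
have memE p : p <= m -> ((0 < p <= i) || (j <= p)) = ((0 < p <= i') || (j' <= p)).
  by move=> pm; have := E (inord p); rewrite !inE inordK.
split; apply/eqP; rewrite eqn_leq; apply/andP; split.
- by have := memE i; lia.
- by have := memE i'; lia.
- by have := memE j' jm'; lia.
- by have := memE j jm; lia.
Qed.

Lemma gapset_closed m i j (a : {perm 'I_m.+1}) : 0 < i -> i < j -> involutive a ->
  stable a (gapset m i j) -> chord_closed (cut a ord0) (gapset m i j).
Proof.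
move=> i0 ij aK sS; apply/chord_closedP; split=> [|u v]; first exact: cut_stable.
rewrite /crosses !(cut_involE _ _ aK).
case: ifPn => uR; first by move/and3P=> [uv vu _]; lia.
case: ifPn => vR; first by move/and3P=> [_ vau auv]; lia.
have anz w : w \notin [set ord0; a ord0] -> 0 < w /\ 0 < a w.
  rewrite !inE negb_or => /andP[w0 wa0].
  have aw0 : a w != ord0 by apply: contraNneq wa0 => <-; rewrite aK.
  by move: w0 aw0; rewrite -!val_eqE /= -!lt0n.
have [u0 au0] := anz u uR; have [v0 av0] := anz v vR.
have := stableP _ _ sS u; have := stableP _ _ sS v; rewrite !inE.
by clear - ij u0 au0 v0 av0; lia.
Qed.

Definition root_component m (a : {perm 'I_m.+1}) :=
  component (chord_closed (cut a ord0)) (inord 1).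

Section ChordGlue.
Variables (m i j : nat) (a1 a2 : {perm 'I_m.+1}).
Hypotheses (i0 : 0 < i) (ijm : i < j <= m).
Local Notation S := (gapset m i j).
Hypotheses (D1 : connected_involution S a1) (D2 : connected_involution (~: S) a2).
Implicit Type A : {set 'I_m.+1}.

Let SCS : [disjoint S & ~: S]. Proof. by rewrite disjoints_subset setCK. Qed.
Let a1S : perm_on S a1 := connected_involution_on D1.
Let a2S : perm_on (~: S) a2 := connected_involution_on D2.
Let root_notin : ord0 \notin S. Proof. by rewrite inE /=; lia. Qed.
Let root_in : ord0 \in ~: S. Proof. by rewrite inE. Qed.
Let one_in : inord 1 \in S. Proof. by rewrite inE inordK; lia. Qed.

Let prodl : {in S, a1 =1 (a1 * a2)%g}.
Proof.
by move=> y yS; rewrite permM (out_perm a2S) // inE negbK (perm_closed _ a1S).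
Qed.

Let prodr : {in ~: S, a2 =1 (a1 * a2)%g}.
Proof. by move=> y yS; rewrite permM (out_perm a1S) -1?in_setC. Qed.

Lemma stable_chord_glue : stable (a1 * a2)%g S.
Proof. by apply: groupM; [|rewrite -stableC]; apply: perm_on_stable. Qed.

Lemma fixing_involution_chord_glue : fixing_involution set0 (a1 * a2)%g.
Proof.
have /andP[F1 _] := D1; have /andP[F2 _] := D2.
by have := fixing_involutionM (subxx _) F1 F2; rewrite setICr.
Qed.

Lemma chord_spanning_gap : exists2 u : 'I_m.+1, 0 < u <= i & j <= a1 u.
Proof.
apply/exists_inP; apply: contraT => /exists_inPn no_span.
pose L := [set p : 'I_m.+1 | 0 < p <= i].
have L_closed (u : 'I_m.+1) : u \in L -> a1 u \in L.
  rewrite !inE => uL; have /negP := no_span u uL.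
  have : a1 u \in S by rewrite (perm_closed _ a1S) inE uL.
  by rewrite inE; clear; lia.
have cL : chord_closed a1 L.
  apply/chord_closedP; split.
    exact: stable_involutive (connected_involution_involutive D1) L_closed.
  move=> u v uv; have /andP[uS _] := crosses_on a1S uv; case/and3P: uv => uv vau _.
  apply/idP/idP => [/L_closed|]; move: uS; rewrite !inE; clear - uv vau ijm; lia.
have oneL : inord 1 \in L by rewrite inE inordK //; clear - i0 ijm; lia.
have /subsetP/(_ ord_max) := connected_involution_sub D1 cL one_in oneL.
by rewrite !inE /=; clear - ijm; lia.
Qed.

(* A chord of the first diagram spanning the gap crosses the root chord. *)
Lemma chord_glue : connected_involution setT (a1 * a2)%g.
Proof.
apply/andP; split; first by rewrite setCT fixing_involution_chord_glue.
apply: (inseparable_from (@chord_closedC _ _) (in_setT ord0)) => A cA rootA.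
have c1 := chord_closed_restrict a1S prodl cA.
have c2 := chord_closed_restrict a2S prodr cA.
have SCA := connected_involution_sub D2 c2 root_in rootA.
have [u ui aui] := chord_spanning_gap; have uS : u \in S by rewrite inE ui.
have bS : a2 ord0 \in ~: S by rewrite (perm_closed _ a2S).
have b0 := connected_involution_neq D2 root_in.
have cross_u : crosses (a1 * a2)%g ord0 u.
  move: bS b0; rewrite /crosses -(prodr root_in) -(prodl uS) !inE ord_neq_ltn /=.
  by clear - ui aui; lia.
have [_ crossA] := chord_closedP _ _ cA.
have uA : u \in A by rewrite -(crossA _ _ cross_u).
by rewrite -(setUCr S) subUset SCA (connected_involution_sub D1 c1 uS uA).
Qed.

Lemma chord_glue_root : i < (a1 * a2)%g ord0 < j.
Proof.
have := connected_involution_neq chord_glue (in_setT ord0).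
have := stableP _ _ stable_chord_glue ord0.
by rewrite !inE ord_neq_ltn /=; clear - ijm; lia.
Qed.

Lemma root_component_chord_glue : root_component (a1 * a2)%g = S.
Proof.
have aK := connected_involution_involutive chord_glue.
have cS := gapset_closed i0 (proj1 (andP ijm)) aK stable_chord_glue.
apply/eqP; rewrite eqEsubset; apply/andP; split.
  by apply: bigcap_inf; rewrite cS one_in.
have cut_prodl : {in S, a1 =1 cut (a1 * a2) ord0}.
  move=> y yS; rewrite (cutMr SCS a1S a2S root_notin) permM.
  by rewrite (out_perm (perm_on_cut root_in a2S)) // inE negbK (perm_closed _ a1S).
apply: (connected_involution_sub D1 _ one_in (mem_component _ _)).
apply: chord_closed_restrict a1S cut_prodl _.
exact: component_closed (chord_closedT _) (@chord_closedI _ _).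
Qed.

End ChordGlue.

Lemma chord_glue_inj m i j i' j' (a1 a2 b1 b2 : {perm 'I_m.+1}) :
  0 < i -> i < j <= m -> 0 < i' -> i' < j' <= m ->
  connected_involution (gapset m i j) a1 -> connected_involution (~: gapset m i j) a2 ->
  connected_involution (gapset m i' j') b1 ->
  connected_involution (~: gapset m i' j') b2 ->
  (a1 * a2 = b1 * b2)%g -> [/\ i = i', j = j', a1 = b1 & a2 = b2].
Proof.
move=> i0 ijm i0' ijm' A1 A2 B1 B2 E.
have ES : gapset m i j = gapset m i' j'.
  rewrite -(root_component_chord_glue i0 ijm A1 A2) E.
  exact: root_component_chord_glue.
have b_gap := chord_glue_root i0 ijm A1 A2.
have b_gap' := chord_glue_root i0' ijm' B1 B2; rewrite -E in b_gap'.
have [jm jm'] : j <= m /\ j' <= m by case/andP: ijm; case/andP: ijm'.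
have [ii jj] := gapset_inj b_gap b_gap' jm jm' ES; subst i' j'.
have D : [disjoint gapset m i j & ~: gapset m i j] by rewrite disjoints_subset setCK.
by have [-> ->] := perm_on_mul_inj D
  (connected_involution_on A1) (connected_involution_on A2)
  (connected_involution_on B1) (connected_involution_on B2) E.
Qed.

(** * Removing the root chord *)

Section ChordUnglue.
Variables (m : nat) (a : {perm 'I_m.+1}).
Hypotheses (m1 : 1 < m) (D : connected_involution setT a).
Implicit Types (u v p s y : 'I_m.+1) (A : {set 'I_m.+1}).

Local Notation b := (a ord0).
Local Notation a' := (cut a ord0).
Local Notation S := (root_component a).

Let aK : involutive a := connected_involution_involutive D.

Let one : (inord 1 : 'I_m.+1) = 1 :> nat. Proof. by rewrite inordK //; lia. Qed.

Let chord_closed_full A y : chord_closed a A -> y \in A -> A = setT.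
Proof.
move=> cA yA; apply/eqP.
by rewrite -subTset (connected_involution_sub D cA (in_setT y) yA).
Qed.

Let b_gt0 : 0 < b.
Proof. by have := connected_involution_neq D (in_setT ord0); rewrite -val_eqE -lt0n. Qed.

Let crosses_notin_root u v : crosses a u v -> [/\ u != b, v != b & v != ord0].
Proof.
case/and3P=> uv vau auav; split; apply/eqP => E; move: uv vau auav; rewrite E ?aK /=; lia.
Qed.

Let a'E y : y != ord0 -> y != b -> a' y = a y. Proof. exact: cut_neq. Qed.

Let crosses_cut u v : crosses a u v -> u != ord0 -> crosses a' u v.
Proof.
by move=> uv u0; have [ub vb v0] := crosses_notin_root uv; rewrite /crosses !a'E.
Qed.

Let cS : chord_closed a' S.
Proof. exact: component_closed (chord_closedT _) (@chord_closedI _ _). Qed.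

Let one_in : inord 1 \in S. Proof. exact: mem_component. Qed.

Let S_sub A y : chord_closed a' A -> y \in S -> y \in A -> S \subset A.
Proof. exact: inseparable_sub (component_inseparable _ (@chord_closedC _ _)). Qed.

Let root_pair_stable : stable a [set ord0; b].
Proof.
by apply: stable_involutive => // y /set2P[]->; rewrite ?aK ?set21 ?set22.
Qed.

Lemma root_chord_gt1 : 1 < b.
Proof.
rewrite ltnNge; apply/negP => b_le1.
have b1 : b = 1 :> nat by apply/eqP; rewrite eqn_leq b_le1.
have root_closed : chord_closed a [set ord0; b].
  apply/chord_closedP; split=> // u v uv.
  have [ub vb v0] := crosses_notin_root uv.
  rewrite !inE (negPf ub) (negPf vb) (negPf v0) orbF.
  by apply/eqP => u0; case/and3P: uv; rewrite u0 b1 /=; lia.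
have : inord 2 \in [set ord0; b].
  by rewrite (chord_closed_full root_closed (set21 _ _)) inE.
by rewrite !inE -!val_eqE /= inordK ?b1.
Qed.

Lemma root_component_sub : S \subset ~: [set ord0; b].
Proof.
have root_closed : chord_closed a' [set ord0; b].
  apply/chord_closedP; split=> [|u v]; first exact: cut_stable.
  rewrite /crosses !(cut_involE _ _ aK).
  case: ifP => uR; first by move/and3P=> [uv vu _]; lia.
  by case: ifP => vR; [move/and3P=> [_ vau auv]; lia |].
apply: (S_sub (chord_closedC root_closed) one_in).
by rewrite !inE -!val_eqE /= one; have := root_chord_gt1; lia.
Qed.

Let S_neq y : y \in S -> [/\ y != ord0, y != b & a' y = a y].
Proof.
move/(subsetP root_component_sub); rewrite !inE negb_or => /andP[y0 yb].
by rewrite a'E.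
Qed.

Let root_notin : ord0 \notin S. Proof. by apply/negP => /S_neq[]; rewrite eqxx. Qed.

Lemma root_component_stable : stable a S.
Proof.
have [sS _] := chord_closedP _ _ cS.
apply: stable_involutive => // y yS.
by have [_ _ <-] := S_neq yS; rewrite (stableP _ _ sS).
Qed.

Let aS y : (a y \in S) = (y \in S).
Proof. exact: (stableP _ _ root_component_stable). Qed.

Let crosses_S u v : crosses a u v -> u != ord0 -> (u \in S) = (v \in S).
Proof. by move=> uv u0; apply: (chord_closedP _ _ cS).2; apply: crosses_cut. Qed.

(* Otherwise the part of [S] under the chord of [p] would be closed, hence all of
   [S], although [1] is in [S]. *)
Lemma root_component_not_nested p s :
  p \notin S -> p != ord0 -> s \in S -> p < s -> ~~ (s < a p).
Proof.
move=> pS p0 sS ps; apply/negP => sap.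
pose B := S :&: [set q : 'I_m.+1 | p < q < a p].
have neq_p q : q \in S -> (q : nat) != p /\ (q : nat) != a p.
  by move=> qS; split; apply: contraNneq pS => /val_inj E; [rewrite -E|rewrite -aS -E].
have sB : stable a' B.
  apply: (stable_involutive (cut_involutive _ aK)) => q.
  rewrite !inE => /and3P[qS pq qap].
  have [_ _ ->] := S_neq qS; have aqS : a q \in S by rewrite aS.
  have [aqp aqap] := neq_p _ aqS; have [aq0 _ _] := S_neq aqS; rewrite aqS /=.
  have not_cross_left : ~~ crosses a (a q) p by apply: contraNN pS => /crosses_S <-.
  have not_cross_right : ~~ crosses a p q by apply: contraNN pS => /crosses_S ->.
  move: not_cross_left not_cross_right; rewrite /crosses aK.
  by clear - pq qap aqp aqap; lia.
have cB : chord_closed a' B.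
  have [/stableP sS' cS'] := chord_closedP _ _ cS.
  apply/chord_closedP; split=> // u v uv; have uvS := cS' u v uv.
  have := stableP _ _ sB u; have := stableP _ _ sB v; rewrite !inE !sS' uvS.
  by case/and3P: uv; case: (v \in S) => //=; clear; lia.
have := subsetP (S_sub cB sS (_ : s \in B)) _ one_in.
rewrite !inE sS ps sap one => /(_ isT)/and3P[_ p_lt1 _].
by move: p0; rewrite -val_eqE /=; clear - p_lt1; lia.
Qed.

Lemma root_component_above_root : exists2 w : 'I_m.+1, w \in S & b < w.
Proof.
apply/exists_inP; apply: contraT => /exists_inPn no_above.
have cSa : chord_closed a S.
  apply/chord_closedP; split=> [|u v uv]; first exact: root_component_stable.
  have [u0|u0] := eqVneq u ord0; last exact: crosses_S.
  rewrite u0 (negPf root_notin); apply/esym/negbTE; rewrite -aS.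
  by apply/negP => /no_above; case/and3P: uv => _ _; rewrite u0 => ->.
by have := root_notin; rewrite (chord_closed_full cSa one_in) inE.
Qed.

Lemma root_component_max_below :
  exists2 i, i \in S & i < b /\ forall s, s \in S -> s < b -> s <= i.
Proof.
have one_below : (inord 1 \in S) && ((inord 1 : 'I_m.+1) < b).
  by rewrite one_in one root_chord_gt1.
have [i /andP[iS ib] imax] :=
  @arg_maxnP _ (inord 1) (fun s => (s \in S) && (s < b)) val one_below.
by exists i => //; split=> // s sS sb; apply: imax; rewrite sS.
Qed.

Lemma root_component_min_above :
  exists2 j, j \in S & b < j /\ forall s, s \in S -> b < s -> j <= s.
Proof.
have [w wS bw] := root_component_above_root.
have w_above : (w \in S) && (b < w) by rewrite wS.
have [j /andP[jS bj] jmin] :=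
  @arg_minnP _ w (fun s => (s \in S) && (b < s)) val w_above.
by exists j => //; split=> // s sS bs; apply: jmin; rewrite sS.
Qed.

Section ComponentEnds.
Variables i j : 'I_m.+1.
Hypotheses (iS : i \in S) (jS : j \in S) (ib : i < b) (bj : b < j).

Let gapP y : y != ord0 -> (y \in ~: gapset m i j) = (i < y < j).
Proof. by rewrite !inE -val_eqE /= => y0; lia. Qed.

Let notin_neq y : y \notin S -> (y : nat) != i /\ (y : nat) != j.
Proof. by move=> yS; split; apply: contraNneq yS => /val_inj ->. Qed.

Local Notation W := (S :|: ~: gapset m i j).

Lemma gap_union_stable : stable a W.
Proof.
apply: stable_involutive => // y; rewrite !in_setU aS.
have [//|yS] := boolP (y \in S); have ayS : a y \notin S by rewrite aS.
have [->|y0] := eqVneq y ord0.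
  by rewrite (gapP (connected_involution_neq D (in_setT _))) ib.
have [->|yb] := eqVneq y b; first by rewrite aK !inE /=; clear - bj; lia.
have ay0 : a y != ord0 by apply: contraNneq yb => <-; rewrite aK.
rewrite !gapP //= => iyj; have [ayi ayj] := notin_neq ayS.
have := root_component_not_nested ayS ay0 iS; rewrite aK.
by have := root_component_not_nested yS y0 jS; clear - iyj ayi ayj; lia.
Qed.

(* No chord outside [S] leaves the gap around [b], as it would pass over [i] or [j]. *)
Lemma gap_union_closed : chord_closed a W.
Proof.
have sW := gap_union_stable; apply/chord_closedP; split=> // u v uv.
have [ub vb v0] := crosses_notin_root uv.
have [u0|u0] := eqVneq u ord0.
  have root_gap : ord0 \in ~: gapset m i j by rewrite !inE -ltnNge (leq_ltn_trans _ bj).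
  rewrite u0 !in_setU root_gap orbT.
  have [//|vS] := boolP (v \in S); have [vi _] := notin_neq vS.
  rewrite gapP //=; have := root_component_not_nested vS v0 iS.
  by case/and3P: uv => _; rewrite u0; clear - vi ib bj; lia.
have uvS := crosses_S uv u0; rewrite !in_setU uvS; have [//|vS] := boolP (v \in S).
have uS : u \notin S by rewrite uvS.
have := stableP _ _ sW u; rewrite !in_setU aS (negPf uS) /=.
have au0 : a u != ord0 by apply: contraNneq ub => <-; rewrite aK.
rewrite !gapP //; have [ui _] := notin_neq uS; have := root_component_not_nested uS u0 iS.
by case/and3P: uv; clear - ui; lia.
Qed.

End ComponentEnds.

Lemma root_component_gapset : exists i j, [/\ 0 < i, i < j <= m & S = gapset m i j].
Proof.
have [i iS [ib imax]] := root_component_max_below.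
have [j jS [bj jmin]] := root_component_min_above.
exists i, j; split.
- by apply: leq_trans (imax _ one_in _); rewrite one ?root_chord_gt1.
- by rewrite (ltn_trans ib bj) -ltnS ltn_ord.
apply/setP => p; apply/idP/idP => pS; last first.
  have := chord_closed_full (gap_union_closed iS jS ib bj) (y := i).
  by rewrite inE iS => /(_ isT)/setP/(_ p); rewrite !in_setU in_setC pS orbF in_setT.
have [p0 pb _] := S_neq pS; rewrite inE lt0n p0 /=.
by move: pb; rewrite ord_neq_ltn => /orP[/(imax p pS)->|/(jmin p pS)->]; rewrite ?orbT.
Qed.

Lemma root_component_connected : connected_involution S (restr_perm S a).
Proof.
have /andP[F _] := D; apply/andP; split.
  by have := fixing_involution_restr root_component_stable F; rewrite setCT set0U.
have restrE : {in S, restr_perm S a =1 a'}.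
  move=> y yS; rewrite restr_permE_if ?root_component_stable // yS.
  by have [_ _ ->] := S_neq yS.
apply/inseparableP => A /(chord_closed_extend restrE cS) cAS x y xS yS.
have insep := component_inseparable (inord 1) (@chord_closedC _ a').
have := inseparableP _ _ insep _ cAS x y xS yS.
by rewrite !in_setI xS yS !andbT.
Qed.

Lemma root_componentC_connected : connected_involution (~: S) (restr_perm (~: S) a).
Proof.
have sSC : stable a (~: S) by rewrite stableC root_component_stable.
have /andP[F _] := D; apply/andP; split.
  by have := fixing_involution_restr sSC F; rewrite setCT set0U.
have rootSC : ord0 \in ~: S by rewrite inE.
apply: (inseparable_from (@chord_closedC _ _) rootSC) => A /chord_closedP[sA cA] rootA.
have crossE u v : u \notin S -> v \notin S -> crosses a u v -> (u \in A) = (v \in A).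
  move=> uS vS uv; apply: cA.
  by rewrite /crosses !restr_permE_if // !in_setC uS vS.
have cAS : chord_closed a (A :|: S).
  apply/chord_closedP; split=> [|u v uv].
    apply: stable_involutive => // y; rewrite !in_setU aS.
    have [|yS] := boolP (y \in S); rewrite ?orbT // !orbF => yA.
    by have := stableP _ _ sA y; rewrite restr_permE_if // in_setC yS => ->.
  rewrite !in_setU; have [u0|u0] := eqVneq u ord0.
    rewrite u0 rootA /=; have [|vS] := boolP (v \in S); rewrite ?orbT // orbF.
    by rewrite -(crossE ord0 v) // -u0.
  rewrite (crosses_S uv u0); have [|vS] := boolP (v \in S); rewrite ?orbT // !orbF.
  by apply: crossE; rewrite // (crosses_S uv u0).
have rootAS : ord0 \in A :|: S by rewrite in_setU rootA.
apply/subsetP => y; rewrite in_setC => yS.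
have /setP/(_ y) := chord_closed_full cAS rootAS.
by rewrite in_setU (negPf yS) orbF in_setT.
Qed.

Lemma chord_unglue : exists i j, [/\ 0 < i, i < j <= m, stable a (gapset m i j),
  connected_involution (gapset m i j) (restr_perm (gapset m i j) a) &
  connected_involution (~: gapset m i j) (restr_perm (~: gapset m i j) a)].
Proof.
have [i [j [i0 ijm SE]]] := root_component_gapset; exists i, j; rewrite -SE; split=> //.
- exact: root_component_stable.
- exact: root_component_connected.
- exact: root_componentC_connected.
Qed.

End ChordUnglue.

(** * Counting chord diagrams *)

Section CountChordGluings.
Variable m : nat.
Local Notation gluing := (('I_m * 'I_m) * ({perm 'I_m.+1} * {perm 'I_m.+1}))%type.

(* The pair [(t, i)] stands for a component with [t.+1] endpoints, the first [i] of which
   precede the gap. *)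
Definition component_gapset (p : 'I_m * 'I_m) := gapset m p.2 (p.2 + (m - p.1)).

Definition chord_gluing_parts (p : 'I_m * 'I_m) :=
  setX (connected_involutions (component_gapset p))
       (connected_involutions (~: component_gapset p)).

Definition chord_gluings : {set gluing} :=
  [set q : gluing | (0 < q.1.2 <= q.1.1) && (q.2 \in chord_gluing_parts q.1)].

Definition glue_chords (q : gluing) := (q.2.1 * q.2.2)%g.

Lemma gap_bounds (p : 'I_m * 'I_m) : 0 < p.2 <= p.1 -> p.2 < p.2 + (m - p.1) <= m.
Proof. by case: p => t i /=; have := ltn_ord t; lia. Qed.

Lemma chord_gluingsP (p : 'I_m * 'I_m) a1 a2 :
  reflect [/\ 0 < p.2 <= p.1, connected_involution (component_gapset p) a1 &
              connected_involution (~: component_gapset p) a2]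
    ((p, (a1, a2)) \in chord_gluings).
Proof. by rewrite inE in_setX !inE /=; apply: and3P. Qed.

Lemma glue_chord_gluings :
  1 < m -> glue_chords @: chord_gluings = connected_involutions setT.
Proof.
move=> m1; apply/esym/setP => a; apply/idP/imsetP; last first.
  move=> [[p [a1 a2]] /chord_gluingsP[ip D1 D2] ->].
  by rewrite inE (chord_glue _ (gap_bounds ip) D1 D2) //; case/andP: ip.
rewrite inE => /(chord_unglue m1)[i [j [i0 ijm aS D1 D2]]].
have im : i < m by clear - ijm; lia.
have tm : i + m - j < m by clear - ijm; lia.
pose p := (Ordinal tm, Ordinal im).
have pS : component_gapset p = gapset m i j by congr gapset; rewrite /=; clear - ijm; lia.
exists (p, (restr_perm (gapset m i j) a, restr_perm (~: gapset m i j) a)).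
  by apply/chord_gluingsP; rewrite pS; split=> //=; clear - ijm i0; lia.
by rewrite /glue_chords restr_permM_setC.
Qed.

Lemma glue_chords_inj : {in chord_gluings &, injective glue_chords}.
Proof.
move=> [p [a1 a2]] [q [b1 b2]] /chord_gluingsP[ip A1 A2] /chord_gluingsP[iq B1 B2] E.
have [p0 _] := andP ip; have [q0 _] := andP iq.
have [Ei Ej -> ->] :=
  chord_glue_inj p0 (gap_bounds ip) q0 (gap_bounds iq) A1 A2 B1 B2 E.
case: p q Ei Ej {E ip iq p0 q0 A1 A2 B1 B2} => [t i] [t' i'] /= /val_inj-> Ej.
congr (_, _, _); apply/val_inj => /=; have := ltn_ord t; have := ltn_ord t'.
by move: Ej; clear; lia.
Qed.

Lemma card_chord_gluings :
  #|chord_gluings| = \sum_(p : 'I_m * 'I_m | 0 < p.2 <= p.1)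
    num_connected_involutions p.1.+1 * num_connected_involutions (m - p.1).
Proof.
transitivity (\sum_(p : 'I_m * 'I_m | 0 < p.2 <= p.1) #|chord_gluing_parts p|).
  exact: card_dep_pairs.
apply: eq_bigr => -[t i] ip; rewrite cardsX !card_connected_involutions.
rewrite card_gapset ?card_gapsetC ?gap_bounds // addKn.
congr (num_connected_involutions _ * _).
by have := ltn_ord t; move: ip; clear; rewrite /=; lia.
Qed.

End CountChordGluings.

Lemma num_connected_involutions_rec m : 1 < m ->
  num_connected_involutions m.+1 =
  \sum_(t < m) t * num_connected_involutions t.+1 * num_connected_involutions (m - t).
Proof.
move=> m1; rewrite /num_connected_involutions -glue_chord_gluings //.
rewrite (card_in_imset (@glue_chords_inj m)) card_chord_gluings.
transitivity (\sum_(t : 'I_m) \sum_(i : 'I_m | 0 < i <= t)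
    num_connected_involutions t.+1 * num_connected_involutions (m - t)).
  by rewrite pair_big_dep.
apply: eq_bigr => t _; rewrite sum_nat_const mulnA; congr (_ * _ * _).
rewrite -[RHS](subn1 t.+1) -(card_ord_itv 1 (ltn_ord t)).
by apply: eq_card => i; rewrite inE.
Qed.

Lemma num_bridgeless_labelled_mapsE N :
  num_bridgeless_labelled_maps N = N`! * num_connected_involutions N.+1.
Proof.
elim/ltn_ind: N => -[|[|N]] IH.
- by rewrite num_bridgeless_labelled_maps0 num_connected_involutions1.
- by rewrite num_bridgeless_labelled_maps1 num_connected_involutions2.
set M := N.+2 in IH *.
rewrite num_bridgeless_labelled_maps_rec // num_connected_involutions_rec //.
rewrite big_distrr /=; apply: eq_bigr => j _; have jM := ltn_ord j.
have subMj : (M.-1 - j).+1 = M - j by rewrite /M in jM *; lia.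
rewrite !IH //; last by rewrite /M; lia.
rewrite subMj -(bin_fact (ltnW jM)) -subMj factS subMj.
move: 'C(M, j) (M - j) (M.-1 - j)`! j`! (num_connected_involutions j.+1) => c d e f g.
by move: (num_connected_involutions d) (nat_of_ord j) => k l; lia.
Qed.

(** * From involutions to perfect matchings *)

Section Matchings.
Variable m : nat.
Implicit Types (a : {perm 'I_m}) (A C D : {set 'I_m}) (P : {set {set 'I_m}}).
Implicit Types u v y : 'I_m.

Lemma porbits_perfect_matching a :
  connected_involution setT a -> perfect_matching (porbits a).
Proof.
move=> D; rewrite /perfect_matching porbits_partition.
apply/forall_inP => _ /imsetP[x _ ->].
rewrite (porbit_involutive _ (connected_involution_involutive D)) cards2 [x == _]eq_sym.
by rewrite (connected_involution_neq D) ?inE.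
Qed.

Lemma chords_crossC C D : chords_cross C D -> chords_cross D C.
Proof.
move=> /existsP[u /existsP[v /existsP[w /existsP[z /and3P[CE DE cross]]]]].
apply/existsP; exists w; apply/existsP; exists z.
by apply/existsP; exists u; apply/existsP; exists v; rewrite CE DE orbC.
Qed.

Lemma chords_cross_porbits a u v :
  involutive a -> crosses a u v -> chords_cross (porbit a u) (porbit a v).
Proof.
move=> aK /and3P[uv vau auav]; apply/existsP; exists u; apply/existsP; exists (a u).
apply/existsP; exists v; apply/existsP; exists (a v).
by rewrite !(porbit_involutive _ aK) !eqxx uv vau auav.
Qed.

Lemma porbits_chordE a C u v : involutive a ->
  C \in porbits a -> u < v -> C = [set u; v] -> C = porbit a u /\ v = a u.
Proof.
move=> aK /imsetP[z _ ->] uv E.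
have /eqP Eu : porbit a u == porbit a z by rewrite eq_porbit_mem E set21.
split=> //; have : v \in porbit a u by rewrite Eu E set22.
rewrite porbit_involutive // => /set2P[] // vu.
by rewrite vu ltnn in uv.
Qed.

Lemma cross_relP a C D : involutive a -> cross_rel (porbits a) C D ->
  exists u v, [/\ C = porbit a u, D = porbit a v & crosses a u v || crosses a v u].
Proof.
move=> aK /and3P[CP DP /existsP[u /existsP[v /existsP[c /existsP[d]]]]].
case/and3P=> /eqP EC /eqP ED cross.
have [uv cd] : u < v /\ c < d by move: cross; lia.
have [-> vE] := porbits_chordE aK CP uv EC.
have [-> dE] := porbits_chordE aK DP cd ED.
by exists u, c; split; rewrite // /crosses -vE -dE !andbA.
Qed.

Lemma cross_rel_closed a A : involutive a -> chord_closed a A ->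
  closed (cross_rel (porbits a)) [pred C : {set 'I_m} | C \subset A].
Proof.
move=> aK /chord_closedP[sA cA] C D /(cross_relP aK)[u [v [-> -> uv]]].
by rewrite !inE !porbit_sub_stable //; case/orP: uv => /cA.
Qed.

Lemma diagram_connected_porbits a : involutive a ->
  diagram_connected (porbits a) = inseparable (chord_closed a) setT.
Proof.
move=> aK; apply/forall_inP/inseparableP => [conn A cA y z _ _|insep].
  have [sA _] := chord_closedP _ _ cA; rewrite -!(porbit_sub_stable _ sA).
  have /forall_inP/(_ _ (mem_porbits a z)) := conn _ (mem_porbits a y).
  exact: (closed_connect (cross_rel_closed aK cA)).
move=> _ /imsetP[y _ ->]; apply/forall_inP => _ /imsetP[z _ ->].
pose e := cross_rel (porbits a).
pose A := [set w | connect e (porbit a y) (porbit a w)].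
suff cA : chord_closed a A.
  by have := insep A cA y z (in_setT y) (in_setT z); rewrite !inE connect0.
apply/chord_closedP; split=> [|u v uv].
  by apply/stableP => w; rewrite !inE (porbit_perm a 1).
have /andP[e_uv e_vu] : e (porbit a u) (porbit a v) && e (porbit a v) (porbit a u).
  have uv_cross := chords_cross_porbits aK uv.
  by rewrite /e /cross_rel !mem_porbits uv_cross chords_crossC.
by rewrite !inE; apply/idP/idP => y_conn;
  apply: connect_trans y_conn (connect1 _).
Qed.

Lemma perfect_matching_involution P : perfect_matching P ->
  exists2 a, fixing_involution set0 a & P = porbits a.
Proof.
case/andP=> partP /forall_inP card2; have [/eqP covP trivP _] := and3P partP.
have inP y : y \in cover P by rewrite covP inE.
have blockP y : pblock P y \in P by rewrite pblock_mem.
pose f y := odflt y [pick z in pblock P y :\ y].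
have fP y : f y != y /\ pblock P y = [set y; f y].
  have := cardsD1 y (pblock P y); rewrite (eqP (card2 _ (blockP y))) mem_pblock inP.
  move=> [/esym/eqP/cards1P[w wE]].
  have fE : f y = w.
    rewrite /f; case: pickP => [z|/(_ w)]; rewrite wE inE ?eqxx //.
    by move=> /eqP.
  have : w \in pblock P y :\ y by rewrite wE inE.
  rewrite fE !inE => /andP[wy _]; split=> //.
  by rewrite -wE setD1K // mem_pblock.
have fK : involutive f.
  move=> y; have [f1 E1] := fP y; have [f2 E2] := fP (f y).
  have E : pblock P (f y) = pblock P y by apply: def_pblock; rewrite // E1 set22.
  have : y \in pblock P (f y) by rewrite E mem_pblock.
  by rewrite E2 !inE eq_sym (negPf f1) => /eqP.
pose a := perm (can_inj fK); have aK : involutive a by move=> y; rewrite !permE fK.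
have blockE y : porbit a y = pblock P y.
  by rewrite porbit_involutive // permE; have [_ ->] := fP y.
exists a.
  apply/fixing_involutionP; split=> // y; rewrite inE permE.
  by have [/negPf] := fP y.
apply/setP => C; apply/idP/imsetP => [CP|[y _ ->]]; last by rewrite blockE.
have /card_gt0P[y yC] : 0 < #|C| by rewrite (eqP (card2 _ CP)).
by exists y; rewrite // blockE (def_pblock trivP CP yC).
Qed.

Lemma porbits_inj : {in connected_involutions setT &, injective (@porbits 'I_m)}.
Proof.
move=> a b; rewrite !inE => A B E; apply/permP => y.
have : porbit a y \in porbits b by rewrite -E mem_porbits.
case/imsetP=> z _ Ez; have : y \in porbit b z by rewrite -Ez porbit_id.
rewrite -eq_porbit_mem -Ez => /eqP Eab.
have : a y \in porbit b y by rewrite Eab (mem_porbit a 1).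
rewrite (porbit_involutive _ (connected_involution_involutive B)) !inE.
by rewrite (negPf (connected_involution_neq A _)) ?inE // => /eqP.
Qed.

End Matchings.

Lemma card_connected_diagrams n :
  #|connected_diagrams n| = num_connected_involutions n.*2.
Proof.
rewrite /num_connected_involutions -(card_in_imset (@porbits_inj _)).
congr #|pred_of_set _|; apply/setP => P; rewrite inE; apply/andP/imsetP.
  case=> /perfect_matching_involution[a Fa ->] conn; exists a => //.
  have [aK _] := fixing_involutionP _ _ Fa.
  by rewrite inE /connected_involution setCT Fa -diagram_connected_porbits.
move=> [a]; rewrite inE => aD ->; rewrite porbits_perfect_matching //; split=> //.
rewrite diagram_connected_porbits; last exact: connected_involution_involutive aD.
by case/andP: aD.
Qed.

(* A closed rooted map of size n has exactly 2n-1 half-edges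
   (the root plus n-1 two-element alpha-orbits), so its iso classes are
   those of maps with half-edge set 'I_(n.*2.-1). *)
Theorem theorem1p10 (n : nat) (hn : 1 <= n) :
  num_bridgeless_classes n.*2.-1 = #|connected_diagrams n|.
Proof.
apply/eqP; rewrite -(eqn_pmul2r (fact_gt0 n.*2.-1)) -num_bridgeless_labelled_maps_classes.
rewrite num_bridgeless_labelled_mapsE card_connected_diagrams.
by rewrite mulnC prednK // double_gt0.
Qed.
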